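(* For every infinite cardinal $\kappa$ there is a co-existentially closed continuum $X$ of weight $2^\kappa$ such that $\operatorname{rank}(\check{H}^1(X)) \geq 2^\kappa$.
   Context: A continuum is a connected compact Hausdorff space (not necessarily metrizable). The weight of a space is the minimal cardinality of a base. $\check{H}^1$ is first integral Čech cohomology; the rank of an abelian group is the cardinality of a maximal $\mathbb{Z}$-independent subset. $C(X)$ denotes the C*-algebra of continuous complex-valued functions on $X$. $T_{\mathrm{conn}}$ denotes a theory of continuous first-order logic in the language of unital C*-algebras whose models are exactly the C*-algebras isomorphic to $C(X)$ for some continuum $X$. A model $M \models T_{\mathrm{conn}}$ is existentially closed if for every $N \models T_{\mathrm{conn}}$ with $M \subseteq N$, every quantifier-free formula $\phi(\overline{x},\overline{y})$ and every tuple $\overline{b}$ from $M$, $(\inf_{\overline{x}}\phi(\overline{x},\overline{b}))^M = (\inf_{\overline{x}}\phi(\overline{x},\overline{b}))^N$. A continuum $X$ is co-existentially closed if $C(X)$ is an existentially closed model of $T_{\mathrm{conn}}$. *)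

(* Defs.v *)
(* Built on mathcomp-analysis.  [R : realType] plays the role of the field of
   real numbers, and cardinals are represented by types and sets compared with
   [#=] and [#<=]: for a type [K] of cardinality kappa, 2^kappa is the
   cardinality of [set: set K]. *)
From HB Require Import structures.
From mathcomp Require Import all_boot all_order all_algebra.
From mathcomp Require Import generic_quotient.
From mathcomp Require Import all_classical all_reals all_analysis.
From mathcomp Require Import complex ring.

Set Implicit Arguments.
Unset Strict Implicit.
Unset Printing Implicit Defensive.

Import Order.TTheory GRing.Theory Num.Theory numFieldNormedType.Exports.

Local Open Scope classical_set_scope.
Local Open Scope quotient_scope.
Local Open Scope card_scope.
Local Open Scope ring_scope.

Definition continuum (X : topologicalType) : Prop :=
  [/\ [set: X] !=set0, compact [set: X], hausdorff_space X
    & connected [set: X]].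

Definition has_weight (X : topologicalType) (T : Type) (S : set T) : Prop :=
  (exists2 B : set (set X), basis B & B #= S) /\
  (forall B : set (set X), basis B -> S #<= B).

(* [R[i]] through its [numClosedFieldType] instance, which is the one carrying
   the topology. *)
Definition Cplx (R : realType) : numClosedFieldType := R[i]%C.

(* Only the symbols of the language of unital C*-algebras: the models of
   T_conn are the structures isomorphic to some C(X), so that the axioms of
   C*-algebras are automatic for them.  The sorts of the language are the
   balls of radius 0, 1, 2, ... *)
Record cstruct (R : realType) := CStruct {
  ccar :> Type;
  czero : ccar;
  cone : ccar;
  cadd : ccar -> ccar -> ccar;
  cmul : ccar -> ccar -> ccar;
  cscale : Cplx R -> ccar -> ccar;
  cstar : ccar -> ccar;
  cnorm : ccar -> R
}.

Definition cembedding (R : realType) (M N : cstruct R) (f : M -> N) : Prop :=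
  [/\ f (czero M) = czero N /\ f (cone M) = cone N,
      forall a b, f (cadd a b) = cadd (f a) (f b),
      forall a b, f (cmul a b) = cmul (f a) (f b),
      forall l a, f (cscale l a) = cscale l (f a)
    & (forall a, f (cstar a) = cstar (f a)) /\
      (forall a, cnorm (f a) = cnorm a)].

Definition cisomorphic (R : realType) (M N : cstruct R) : Prop :=
  exists2 f : M -> N, cembedding f & bijective f.

Section ContinuousFunctions.
Variables (R : realType) (X : topologicalType).
Local Notation C := (Cplx R).
Implicit Types f g : continuousType X C.

Lemma cts_cst (l : C) : continuous (fun _ : X => l).
Proof. by move=> x; exact: cvg_cst. Qed.

Lemma cts_add f g : continuous (fun x => f x + g x).
Proof. by move=> x; apply: cvgD; exact: cts_fun. Qed.

Lemma cts_mul f g : continuous (fun x => f x * g x).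
Proof. by move=> x; apply: cvgM; exact: cts_fun. Qed.

Lemma cts_scale (l : C) f : continuous (fun x => l * f x).
Proof. by move=> x; apply: cvgM; [exact: cvg_cst|exact: cts_fun]. Qed.

Lemma cts_conj f : continuous (fun x => Num.conj (f x)).
Proof.
move=> x; apply/cvgrPdist_lt => e e0.
have /cvgrPdist_lt/(_ e e0) := @cts_fun _ _ f x.
by apply: filterS => t; rewrite -rmorphB norm_conjC.
Qed.

Definition CX : cstruct R := {|
  ccar := continuousType X C;
  czero := mkcts (@cts_cst 0);
  cone := mkcts (@cts_cst 1);
  cadd f g := mkcts (@cts_add f g);
  cmul f g := mkcts (@cts_mul f g);
  cscale l f := mkcts (@cts_scale l f);
  cstar f := mkcts (@cts_conj f);
  (* [`|f x|] is a complex number, with zero imaginary part *)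
  cnorm f := sup [set complex.Re `|f x| | x in [set: X]]
|}.

End ContinuousFunctions.

Definition models_Tconn (R : realType) (M : cstruct R) : Prop :=
  exists2 X : topologicalType, continuum X & cisomorphic M (CX R X).

Inductive cterm (R : realType) (V : Type) : Type :=
| TVar of V
| TZero
| TOne
| TAdd of cterm R V & cterm R V
| TMul of cterm R V & cterm R V
| TScale of Cplx R & cterm R V
| TStar of cterm R V.

(* The metric is [TNorm] of a difference. *)
Inductive qf_formula (R : realType) (V : Type) : Type :=
| TNorm of cterm R V
| Connective (n : nat) (u : 'rV[R]_n -> R) of
    continuous u & ('I_n -> qf_formula R V).

Fixpoint term_val (R : realType) (M : cstruct R) (V : Type) (e : V -> M)
    (t : cterm R V) : M :=
  match t with
  | TVar v => e v
  | TZero => czero M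
  | TOne => cone M
  | TAdd t1 t2 => cadd (term_val e t1) (term_val e t2)
  | TMul t1 t2 => cmul (term_val e t1) (term_val e t2)
  | TScale l t1 => cscale l (term_val e t1)
  | TStar t1 => cstar (term_val e t1)
  end.

Fixpoint qf_val (R : realType) (M : cstruct R) (V : Type) (e : V -> M)
    (phi : qf_formula R V) : R :=
  match phi with
  | TNorm t => cnorm (term_val e t)
  | Connective n u _ psi => u (\row_i qf_val e (psi i))
  end.

(* The value in M of inf_x phi(x, b), the variable x_i ranging over the ball of
   radius r i.  In a C*-algebra the infimum is over a nonempty set that is
   bounded, the value of phi being bounded on bounded sets. *)
Definition inf_val (R : realType) (M : cstruct R) (m k : nat)
    (phi : qf_formula R ('I_m + 'I_k)) (r : 'I_m -> nat) (b : 'I_k -> M) : R :=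
  inf [set qf_val (fun v => match v with inl i => a i | inr j => b j end) phi
      | a in [set a : 'I_m -> M | forall i, cnorm (a i) <= (r i)%:R]].

Definition existentially_closed (R : realType) (M : cstruct R) : Prop :=
  models_Tconn M /\
  forall (N : cstruct R) (f : M -> N), models_Tconn N -> cembedding f ->
  forall (m k : nat) (phi : qf_formula R ('I_m + 'I_k)) (r : 'I_m -> nat)
    (b : 'I_k -> M),
  inf_val phi r b = inf_val phi r (fun j => f (b j)).

Definition co_existentially_closed (R : realType) (X : topologicalType) : Prop :=
  continuum X /\ existentially_closed (CX R X).

Definition Zindependent (A : zmodType) (S : set A) : Prop :=
  forall (s : seq A) (n : A -> int), uniq s -> {in s, forall a, S a} ->
  \sum_(a <- s) a *~ n a = 0 -> {in s, forall a, n a = 0}.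

Definition max_Zindependent (A : zmodType) (S : set A) : Prop :=
  Zindependent S /\
  forall S' : set A, Zindependent S' -> S `<=` S' -> S' = S.

(* All the maximal independent subsets have the same cardinality. *)
Definition rank_ge (A : zmodType) (T : Type) (B : set T) : Prop :=
  exists2 S : set A, max_Zindependent S & B #<= S.

(* The direct limit, over the open covers U ordered by refinement, of the first
   simplicial cohomology of the nerve of U, computed with ordered cochains.  A
   1-cochain is a function on all pairs of sets, of which only the values on
   the ordered edges of the nerve are relevant. *)
Section Cech.
Variable X : topologicalType.
Implicit Types (U V W : set (set X)) (A B : set X) (p q : set X -> set X).

Definition open_cover U : Prop :=
  U `<=` open /\ \bigcup_(A in U) A = [set: X].

Definition nerve_edge U A B : Prop := [/\ U A, U B & A `&` B !=set0].

Definition nerve_triangle U A B C : Prop :=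
  [/\ U A, U B, U C & A `&` B `&` C !=set0].

Definition cocycle1 U (c : set X -> set X -> int) : Prop :=
  forall A B C, nerve_triangle U A B C -> c B C - c A C + c A B = 0.

Definition coboundary1 U (c : set X -> set X -> int) : Prop :=
  exists g : set X -> int, forall A B, nerve_edge U A B -> c A B = g B - g A.

Definition refinement W U p : Prop :=
  forall A, W A -> U (p A) /\ A `<=` p A.

Definition pull p (c : set X -> set X -> int) A B : int := c (p A) (p B).

Record cech_cocycle := CechCocycle {
  cc_cover : set (set X);
  cc_coverP : open_cover cc_cover;
  cc_val : set X -> set X -> int;
  cc_valP : cocycle1 cc_cover cc_val
}.

HB.instance Definition _ := gen_eqMixin cech_cocycle.
HB.instance Definition _ := gen_choiceMixin cech_cocycle.

(* Equality in the direct limit: the two classes agree on the nerve of a common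
   refinement. *)
Definition cech_eq (c d : cech_cocycle) : Prop :=
  exists W p q, [/\ open_cover W, refinement W (cc_cover c) p,
    refinement W (cc_cover d) q &
    coboundary1 W (fun A B => pull p (cc_val c) A B - pull q (cc_val d) A B)].

Lemma coboundary1_ext W c d : coboundary1 W c ->
  (forall A B, c A B = d A B) -> coboundary1 W d.
Proof. by move=> [g gP] cd; exists g => A B; rewrite -cd; exact: gP. Qed.

Lemma coboundary1D W c d : coboundary1 W c -> coboundary1 W d ->
  coboundary1 W (fun A B => c A B + d A B).
Proof.
move=> [g gP] [h hP]; exists (fun A => g A + h A) => A B e.
by rewrite (gP _ _ e) (hP _ _ e) opprD addrACA.
Qed.

Lemma coboundary1N W c : coboundary1 W c ->
  coboundary1 W (fun A B => - c A B).
Proof.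
move=> [g gP]; exists (fun A => - g A) => A B e.
by rewrite (gP _ _ e) opprD.
Qed.

Lemma coboundary10 W : coboundary1 W (fun _ _ => 0).
Proof. by exists (fun=> 0) => A B _; rewrite subr0. Qed.

Lemma refinement_edge W U p A B : refinement W U p ->
  nerve_edge W A B -> nerve_edge U (p A) (p B).
Proof.
move=> h [/h[pA sA] /h[pB sB] [x [Ax Bx]]]; split=> //.
by exists x; split; [exact: sA|exact: sB].
Qed.

Lemma coboundary1_pull W U p c : refinement W U p ->
  coboundary1 U c -> coboundary1 W (pull p c).
Proof.
move=> h [g gP]; exists (g \o p) => A B e.
by rewrite /pull (gP _ _ (refinement_edge h e)).
Qed.

Lemma cocycle1_pull W U p c : refinement W U p ->
  cocycle1 U c -> cocycle1 W (pull p c).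
Proof.
move=> h cU A B C [/h[UA sA] /h[UB sB] /h[UC sC] [x [[Ax Bx] Cx]]].
apply: cU; split=> //; exists x; split; last exact: sC.
by split; [exact: sA|exact: sB].
Qed.

Lemma cocycle1D U c d : cocycle1 U c -> cocycle1 U d ->
  cocycle1 U (fun A B => c A B + d A B).
Proof.
move=> hc hd A B C t; rewrite -[RHS]addr0 -{1}(hc _ _ _ t) -(hd _ _ _ t).
by ring.
Qed.

Lemma cocycle1N U c : cocycle1 U c -> cocycle1 U (fun A B => - c A B).
Proof. by move=> hc A B C t; rewrite -[RHS]oppr0 -(hc _ _ _ t); ring. Qed.

Lemma cocycle10 U : cocycle1 U (fun _ _ => 0).
Proof. by move=> A B C t; rewrite subr0 addr0. Qed.

(* The map induced on cohomology does not depend on the refinement map. *)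
Lemma pull_indep W U p q c : refinement W U p -> refinement W U q ->
  cocycle1 U c -> coboundary1 W (fun A B => pull p c A B - pull q c A B).
Proof.
move=> hp hq cU; exists (fun A => - c (p A) (q A)) => A B [WA WB [x [Ax Bx]]].
have [UpA /(_ _ Ax) pAx] := hp _ WA; have [UpB /(_ _ Bx) pBx] := hp _ WB.
have [UqA /(_ _ Ax) qAx] := hq _ WA; have [UqB /(_ _ Bx) qBx] := hq _ WB.
have t1 : nerve_triangle U (p A) (p B) (q B) by split=> //; exists x.
have t2 : nerve_triangle U (p A) (q A) (q B) by split=> //; exists x.
rewrite /pull; apply/eqP; rewrite -subr_eq0; apply/eqP.
by rewrite -[RHS](subrr 0) -{1}(cU _ _ _ t1) -(cU _ _ _ t2); ring.
Qed.

Lemma refinement_id U : refinement U U id.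
Proof. by move=> A UA; split. Qed.

Lemma refinement_comp W V U p q : refinement W V p -> refinement V U q ->
  refinement W U (q \o p).
Proof.
move=> hp hq A /hp[/hq[? s] s']; split=> //=; exact: (subset_trans s' s).
Qed.

(* The cover by the intersections, with a choice of the two factors. *)
Definition meet_cover U V : set (set X) :=
  [set A | exists B C, [/\ U B, V C & A = B `&` C]].

Definition meet_fst U V A : set X :=
  xget set0 [set B | U B /\ exists2 C, V C & A = B `&` C].

Definition meet_snd U V A : set X :=
  xget set0 [set C | V C /\ exists2 B, U B & A = B `&` C].

Lemma meet_coverP U V : open_cover U -> open_cover V ->
  open_cover (meet_cover U V).
Proof.
move=> [oU cU] [oV cV]; split.
  by move=> _ [B [C [/oU oB /oV oC ->]]]; exact: openI.
rewrite -subTset => x _.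
have [B UB Bx] : (\bigcup_(A in U) A) x by rewrite cU.
have [C VC Cx] : (\bigcup_(A in V) A) x by rewrite cV.
by exists (B `&` C) => //; exists B, C.
Qed.

Lemma meet_fstP U V : refinement (meet_cover U V) U (meet_fst U V).
Proof.
move=> A [B [C [UB VC AE]]].
have [? [D VD AD]] : [set B | U B /\ exists2 C, V C & A = B `&` C]
    (meet_fst U V A).
  by apply: (@xgetPex _ set0); exists B; split=> //; exists C.
by split=> // x; rewrite {1}AD => -[].
Qed.

Lemma meet_sndP U V : refinement (meet_cover U V) V (meet_snd U V).
Proof.
move=> A [B [C [UB VC AE]]].
have [? [D VD AD]] : [set C | V C /\ exists2 B, U B & A = B `&` C]
    (meet_snd U V A).
  by apply: (@xgetPex _ set0); exists C; split=> //; exists B.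
by split=> // x; rewrite {1}AD => -[].
Qed.

Lemma cech_eq_refl c : cech_eq c c.
Proof.
have rI := @refinement_id (cc_cover c).
exists (cc_cover c), id, id; split=> //; first exact: cc_coverP.
by apply: (coboundary1_ext (coboundary10 _)) => A B; rewrite subrr.
Qed.

Lemma cech_eq_sym c d : cech_eq c d -> cech_eq d c.
Proof.
move=> [W [p [q [hW hp hq cb]]]]; exists W, q, p; split=> //.
by apply: (coboundary1_ext (coboundary1N cb)) => A B; rewrite opprB.
Qed.

Lemma cech_eq_trans c d e : cech_eq c d -> cech_eq d e -> cech_eq c e.
Proof.
move=> [W [p [q [hW hp hq cb]]]] [W' [p' [q' [hW' hp' hq' cb']]]].
have h1 := @meet_fstP W W'; have h2 := @meet_sndP W W'.
exists (meet_cover W W'), (p \o meet_fst W W'), (q' \o meet_snd W W').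
split; [exact: meet_coverP|exact: refinement_comp h1 hp|
  exact: refinement_comp h2 hq'|].
have b1 := coboundary1_pull h1 cb; have b2 := coboundary1_pull h2 cb'.
have b3 := pull_indep (refinement_comp h1 hq) (refinement_comp h2 hp')
  (@cc_valP d).
apply: (coboundary1_ext (coboundary1D (coboundary1D b1 b3) b2)) => A B.
by rewrite /pull /=; ring.
Qed.

Definition cech_eqb (c d : cech_cocycle) : bool := `[< cech_eq c d >].

Lemma cech_eqb_refl : reflexive cech_eqb.
Proof. by move=> c; apply/asboolP/cech_eq_refl. Qed.

Lemma cech_eqb_sym : symmetric cech_eqb.
Proof. by move=> c d; apply/asboolP/asboolP; exact: cech_eq_sym. Qed.

Lemma cech_eqb_trans : transitive cech_eqb.
Proof.
by move=> d c e /asboolP h /asboolP h'; apply/asboolP/(cech_eq_trans h h').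
Qed.

Canonical cech_equiv := EquivRel cech_eqb cech_eqb_refl cech_eqb_sym
  cech_eqb_trans.

Definition cechH1 := {eq_quot cech_equiv}.

HB.instance Definition _ := Choice.on cechH1.

Lemma trivial_coverP : open_cover [set [set: X]].
Proof. by split; [move=> _ ->; exact: openT|rewrite bigcup_set1]. Qed.

Definition cech_zero : cechH1 :=
  \pi_cechH1 (CechCocycle trivial_coverP (@cocycle10 _)).

Definition cech_opp_repr (c : cech_cocycle) : cech_cocycle :=
  CechCocycle (cc_coverP c) (cocycle1N (@cc_valP c)).

Definition cech_add_repr (c d : cech_cocycle) : cech_cocycle :=
  CechCocycle (meet_coverP (cc_coverP c) (cc_coverP d))
    (cocycle1D (cocycle1_pull (@meet_fstP _ _) (@cc_valP c))
               (cocycle1_pull (@meet_sndP _ _) (@cc_valP d))).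

Definition cech_opp (x : cechH1) : cechH1 :=
  \pi_cechH1 (cech_opp_repr (repr x)).

Definition cech_add (x y : cechH1) : cechH1 :=
  \pi_cechH1 (cech_add_repr (repr x) (repr y)).

Lemma pi_cechP c d : \pi_cechH1 c = \pi_cechH1 d <-> cech_eq c d.
Proof.
by split=> [/eqmodP/asboolP//|cd]; apply/eqmodP/asboolP.
Qed.

Lemma repr_cechP c : cech_eq (repr (\pi_cechH1 c)) c.
Proof. by apply/pi_cechP; rewrite reprK. Qed.

Definition cech_class U (hU : open_cover U) c (hc : cocycle1 U c) : cechH1 :=
  \pi_cechH1 (CechCocycle hU hc).

Lemma cech_classP W (hW : open_cover W) c (hc : cocycle1 W c) d
    (hd : cocycle1 W d) : coboundary1 W (fun A B => c A B - d A B) ->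
  cech_class hW hc = cech_class hW hd.
Proof.
by move=> cd; apply/pi_cechP; exists W, id, id; split=> //;
  exact: refinement_id.
Qed.

Lemma cech_class_ext W (hW : open_cover W) c (hc : cocycle1 W c) d
    (hd : cocycle1 W d) : (forall A B, c A B = d A B) ->
  cech_class hW hc = cech_class hW hd.
Proof.
move=> cd; apply/cech_classP/(coboundary1_ext (coboundary10 W)) => A B.
by rewrite cd subrr.
Qed.

Lemma cech_class_pull c W (hW : open_cover W) p
    (hp : refinement W (cc_cover c) p) :
  \pi_cechH1 c = cech_class hW (cocycle1_pull hp (@cc_valP c)).
Proof.
apply/pi_cechP; exists W, p, id; split=> //; first exact: refinement_id.
by apply: (coboundary1_ext (coboundary10 W)) => A B; rewrite subrr.
Qed.

Lemma cech_common (x y z : cechH1) :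
  exists W (hW : open_cover W) a b c (ha : cocycle1 W a) (hb : cocycle1 W b)
    (hc : cocycle1 W c),
  [/\ x = cech_class hW ha, y = cech_class hW hb & z = cech_class hW hc].
Proof.
elim/quotW: x => x; elim/quotW: y => y; elim/quotW: z => z.
have h12 := meet_coverP (cc_coverP x) (cc_coverP y).
have f12 := @meet_fstP (meet_cover (cc_cover x) (cc_cover y)) (cc_cover z).
exists _, (meet_coverP h12 (cc_coverP z)), _, _, _,
  (cocycle1_pull (refinement_comp f12 (@meet_fstP _ _)) (@cc_valP x)),
  (cocycle1_pull (refinement_comp f12 (@meet_sndP _ _)) (@cc_valP y)),
  (cocycle1_pull (@meet_sndP _ _) (@cc_valP z)).
by split; exact: cech_class_pull.
Qed.

Lemma cech_add_reprE c d W (hW : open_cover W) p q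
    (hp : refinement W (cc_cover c) p) (hq : refinement W (cc_cover d) q) :
  \pi_cechH1 (cech_add_repr c d) =
  cech_class hW (cocycle1D (cocycle1_pull hp (@cc_valP c))
                           (cocycle1_pull hq (@cc_valP d))).
Proof.
pose r A := p A `&` q A.
have hr : refinement W (meet_cover (cc_cover c) (cc_cover d)) r.
  move=> A WA; have [cp sp] := hp _ WA; have [dq sq] := hq _ WA.
  by split=> [|x Ax]; [exists (p A), (q A)|split; [exact: sp|exact: sq]].
rewrite (@cech_class_pull (cech_add_repr c d) W hW r hr); apply: cech_classP.
have b1 := pull_indep (refinement_comp hr (@meet_fstP _ _)) hp (@cc_valP c).
have b2 := pull_indep (refinement_comp hr (@meet_sndP _ _)) hq (@cc_valP d).
apply: (coboundary1_ext (coboundary1D b1 b2)) => A B.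
by rewrite /pull /= opprD addrACA.
Qed.

Lemma cech_addE W (hW : open_cover W) c (hc : cocycle1 W c) d
    (hd : cocycle1 W d) :
  cech_add (cech_class hW hc) (cech_class hW hd) =
  cech_class hW (cocycle1D hc hd).
Proof.
have [W1 [p1 [q1 [hW1 hp1 hq1 b1]]]] := repr_cechP (CechCocycle hW hc).
have [W2 [p2 [q2 [hW2 hp2 hq2 b2]]]] := repr_cechP (CechCocycle hW hd).
have f1 := @meet_fstP W1 W2; have f2 := @meet_sndP W1 W2.
have hM := meet_coverP hW1 hW2.
rewrite /cech_add (cech_add_reprE hM (refinement_comp f1 hp1)
  (refinement_comp f2 hp2)).
rewrite [RHS](@cech_class_pull (CechCocycle hW (cocycle1D hc hd)) _ hM _
  (refinement_comp f1 hq1)); apply: cech_classP.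
have c1 := coboundary1_pull f1 b1; have c2 := coboundary1_pull f2 b2.
have c3 := pull_indep (refinement_comp f2 hq2) (refinement_comp f1 hq1) hd.
apply: (coboundary1_ext (coboundary1D (coboundary1D c1 c2) c3)) => A B.
by rewrite /pull /=; ring.
Qed.

Lemma cech_oppE W (hW : open_cover W) c (hc : cocycle1 W c) :
  cech_opp (cech_class hW hc) = cech_class hW (cocycle1N hc).
Proof.
have [W1 [p1 [q1 [hW1 hp1 hq1 b1]]]] := repr_cechP (CechCocycle hW hc).
apply/pi_cechP; exists W1, p1, q1; split=> //.
by apply: (coboundary1_ext (coboundary1N b1)) => A B; rewrite /pull /=; ring.
Qed.

Lemma cech_zeroE W (hW : open_cover W) :
  cech_zero = cech_class hW (@cocycle10 W).
Proof.
apply/pi_cechP; exists W, (fun=> setT), id; split=> //.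
  exact: refinement_id.
by apply: (coboundary1_ext (coboundary10 W)) => A B; rewrite subrr.
Qed.

Lemma cech_addA : associative cech_add.
Proof.
move=> x y z; have [W [hW [a [b [c [ha [hb [hc [-> -> ->]]]]]]]]] :=
  cech_common x y z.
by rewrite !cech_addE; apply: cech_class_ext => A B; rewrite addrA.
Qed.

Lemma cech_addC : commutative cech_add.
Proof.
move=> x y; have [W [hW [a [b [c [ha [hb [hc [-> -> _]]]]]]]]] :=
  cech_common x y x.
by rewrite !cech_addE; apply: cech_class_ext => A B; rewrite addrC.
Qed.

Lemma cech_add0 : left_id cech_zero cech_add.
Proof.
move=> x; have [W [hW [a [b [c [ha [hb [hc [-> _ _]]]]]]]]] :=
  cech_common x x x.
by rewrite (cech_zeroE hW) cech_addE; apply: cech_class_ext => A B; rewrite add0r.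
Qed.

Lemma cech_addN : left_inverse cech_zero cech_opp cech_add.
Proof.
move=> x; have [W [hW [a [b [c [ha [hb [hc [-> _ _]]]]]]]]] :=
  cech_common x x x.
rewrite (cech_zeroE hW) cech_oppE cech_addE.
by apply: cech_class_ext => A B; rewrite addNr.
Qed.

HB.instance Definition _ := GRing.isZmodule.Build cechH1
  cech_addA cech_addC cech_add0 cech_addN.

End Cech.

(* Main.v *)
(* X is co-existentially closed as soon as every finite tuple of functions on a
   continuum Z over X has the same joint range, together with given functions
   on X, as some tuple of functions on X.  By compactness this joint range is
   determined by the rational boxes that it meets, so that there are only
   2^kappa requirements on a continuum in the cube [-1,1]^(2^kappa): its
   continuous functions depend on countably much of a base of size 2^kappa, and
   (2^kappa)^aleph_0 = 2^kappa.  Reserving coordinates of the cube for the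
   witnesses of each requirement, Zorn's lemma on the pairs (set of coordinates
   in use, continuum in these coordinates) gives a continuum X satisfying all
   the requirements that can be satisfied in a continuum over X.

   The construction starts from a wedge of 2^kappa dyadic solenoids, which
   makes the weight of X at least 2^kappa, as X has 2^kappa disjoint nonempty
   open sets.  It has circle-valued functions z_(s,n) with
   z_(s,n+1)^2 = z_(s,n), mapping X onto the circle, and the classes of the
   z_(s,0) in H^1(X) are independent: if a product of their powers is
   exp(2 pi i F), its 2^n-th root formed with the z_(s,n) is a constant times
   exp(2 pi i F / 2^n), which is not onto the circle for n large since F is
   bounded. *)
From mathcomp Require Import all_boot all_order all_algebra.
From mathcomp Require Import all_classical all_reals all_analysis.
From mathcomp Require Import complex ring lra zify.
Require Import Defs.

Set Implicit Arguments.
Unset Strict Implicit.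
Unset Printing Implicit Defensive.

Import Order.TTheory GRing.Theory Num.Theory numFieldNormedType.Exports.

Local Open Scope classical_set_scope.
Local Open Scope card_scope.
Local Open Scope ring_scope.

(** * Cardinals below a power *)

(** The requirements are stated with functions on the cube, while the coordinates of the cube must
    hold the witnesses of the requirements. This circle closes because [L = set K] has the size of
    the set of its countable sequences: all possible requirements inject into [L] beforehand, so
    that none has to be scheduled as it arises. A stage is kept as the full cylinder over its
    continuum, so that all stages are subsets of one cube and an inverse limit of stages is an
    intersection. A later stage projects onto an earlier one. This surjectivity leaves the joint
    ranges of the earlier functions unchanged, so that a requirement once met stays met, and it
    preserves the points over each solenoid on which the rank rests. A continuum Z over a stage may
    have any weight: only its image under the map to the stage and countably many functions enters
    the cube, and that image is connected because Z is. *)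

Definition embeds (T U : Type) : Prop := exists f : T -> U, injective f.

Lemma embeds_refl T : embeds T T.
Proof. by exists id. Qed.

Lemma embeds_trans T U V : embeds T U -> embeds U V -> embeds T V.
Proof. by move=> [f fI] [g gI]; exists (g \o f); exact: inj_comp. Qed.

Lemma embeds_count (T : countType) : embeds T nat.
Proof. by exists pickle; exact: pcan_inj pickleK. Qed.

Lemma embeds_prod T T' U U' : embeds T U -> embeds T' U' ->
  embeds (T * T') (U * U').
Proof.
move=> [f fI] [g gI]; exists (fun x => (f x.1, g x.2)).
by move=> [a b] [c d] /= [/fI -> /gI ->].
Qed.

Lemma embeds_fun A T U : embeds T U -> embeds (A -> T) (A -> U).
Proof.
move=> [f fI]; exists (fun h a => f (h a)) => h k hk; apply/funext => a.
by apply: fI; exact: (congr1 (fun h => h a) hk).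
Qed.

Lemma embeds_set T U : embeds T U -> embeds (set T) (set U).
Proof.
move=> [f fI]; exists (fun A => f @` A).
have sub A B : f @` A = f @` B -> A `<=` B.
  move=> AB x Ax; have : (f @` B) (f x) by rewrite -AB; exists x.
  by move=> [y By /fI <-].
by move=> A B AB; apply/seteqP; split; exact: sub.
Qed.

Lemma card_le_embeds T U (A : set T) (B : set U) : A #<= B ->
  exists f : A -> U, injective f /\ forall x, B (f x).
Proof.
move=> /card_leP[e]; exists (fun x => set_val (e x)); split.
  by move=> x y /val_inj; apply: (@inj _ _ _ e); rewrite inE.
by move=> x; exact: set_valP.
Qed.

Lemma inj_card_le_set T U (A : set T) (B : set U) (f : T -> U) :
  (forall x, A x -> B (f x)) -> (forall x y, A x -> A y -> f x = f y -> x = y) ->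
  A #<= B.
Proof.
move=> fB fI; have : f @` A #= A.
  by apply: inj_card_eq => x y /set_mem Ax /set_mem Ay; exact: fI.
rewrite card_eq_le => /andP[_ h].
by apply: card_le_trans h (subset_card_le _) => _ [x /fB Bx <-].
Qed.

Lemma infinite_set_inj U (B : set U) : infinite_set B ->
  exists e : nat -> U, injective e /\ forall i, B (e i).
Proof.
move=> /infiniteP/card_le_embeds[f [fI fB]].
exists (fun n => f (SigSub (mem_set (I : [set: nat] n)))); split=> [n m|n] //.
by move=> /fI[].
Qed.

(* Zorn on graphs of injections [nat * A -> A] for [A] in [K]; the complement
   of a maximal [A] is finite. *)
Lemma embeds_nat_prod (K : Type) : infinite_set [set: K] ->
  embeds (nat * K) K.
Proof.
move=> infK.
pose dom (G : set (nat * K * K)) : set K :=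
  [set a | exists n y, G (n, a, y)].
pose P : set (set (nat * K * K)) := [set G | [/\
   forall n a, dom G a -> exists2 y, G (n, a, y) & dom G y,
   forall x y y', G (x, y) -> G (x, y') -> y = y',
   forall n a y, G (n, a, y) -> dom G y &
   forall x x' y, G (x, y) -> G (x', y) -> x = x']].
have [F FP Ftot|G [[G1 G2 G3 G4] Gmax]] := Zorn_bigcup (P := P).
  have domF G a : F G -> dom G a -> dom (\bigcup_(X in F) X) a.
    by move=> FG [n [y Gy]]; exists n, y, G.
  have common x y : (\bigcup_(X in F) X) x -> (\bigcup_(X in F) X) y ->
      exists G, [/\ F G, G x & G y].
    move=> [G FG Gx] [H FH Hy]; case: (Ftot _ _ FG FH) => s.
      by exists H; split=> //; exact: s.
    by exists G; split=> //; exact: s.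
  split.
  - move=> n a [m [y [G FG Gy]]]; have [G1 _ _ _] := FP _ FG.
    have [|z Gz dz] := G1 n a; first by exists m, y.
    by exists z; [exists G|exact: domF dz].
  - move=> x y y' h h'; have [G [FG Gy Gy']] := common _ _ h h'.
    by have [_ G2 _ _] := FP _ FG; exact: G2 Gy Gy'.
  - move=> n a y [G FG Gy]; have [_ _ G3 _] := FP _ FG.
    exact/(domF G)/(G3 _ _ _ Gy).
  - move=> x x' y h h'; have [G [FG Gy Gy']] := common _ _ h h'.
    by have [_ _ _ G4] := FP _ FG; exact: G4 Gy Gy'.
pose A := dom G.
have finC : finite_set (~` A).
  apply: contrapT => /infinite_set_inj[e [eI eA]].
  (* A sequence outside [A] carries its own injection, through a pairing of the indices. *)
  pose G' := G `|` [set p | exists n i, p = (n, e i, e (pickle (n, i)))].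
  have domG' a : dom G' a <-> dom G a \/ exists i, a = e i.
    split=> [[n [y [Gy|[m [i [_ -> _]]]]]]|[[n [y Gy]]|[i ->]]].
    - by left; exists n, y.
    - by right; exists i.
    - by exists n, y; left.
    - by exists 0%N, (e (pickle (0%N, i))); right; exists 0%N, i.
  apply: (Gmax G').
    split; first exact: subsetUl.
    move=> GG; apply: (eA 0%N); exists 0%N, (e (pickle (0%N, 0%N))).
    by apply: GG; right; exists 0%N, 0%N.
  split.
  - move=> n a /domG'[da|[i ->]].
      have [y Gy dy] := G1 n a da; exists y; first by left.
      by apply/domG'; left.
    exists (e (pickle (n, i))); first by right; exists n, i.
    by apply/domG'; right; exists (pickle (n, i)).
  - move=> [n a] y y' [Gy|[m [i [-> -> ->]]]] [Gy'|[m' [i' [mm ee ->]]]].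
    + exact: G2 Gy Gy'.
    + by exfalso; apply: (eA i'); rewrite -ee; exists n, y.
    + by exfalso; apply: (eA i); exists m, y'.
    + by rewrite mm (eI _ _ ee).
  - move=> n a y [/G3 dy|[m [i [_ _ ->]]]]; apply/domG'; first by left.
    by right; exists (pickle (m, i)).
  - move=> [n a] [n' a'] y [Gy|[m [i [-> -> ->]]]] [Gy'|[m' [i' [-> -> yy]]]].
    + exact: G4 Gy Gy'.
    + by exfalso; apply: (eA (pickle (m', i'))); rewrite -yy; exact: G3 Gy.
    + by exfalso; apply: (eA (pickle (m, i))); exact: G3 Gy'.
    + by have /(pcan_inj pickleK)[-> ->] := eI _ _ yy.
have [a0 Aa0] : A !=set0.
  apply/set0P/eqP => A0; apply: infK.
  by rewrite -(setC0) -A0.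
have /choice[g gP] : forall x : nat * K, exists y, A x.2 -> G (x, y).
  move=> [n a]; have [da|nda] := pselect (A a); last by exists a.
  by have [y Gy _] := G1 n a da; exists y.
have [j [jI _]] := card_le_embeds (finite_set_countable finC).
pose i a := if pselect (~ A a) is left Aa
  then j (SigSub (mem_set (Aa : (~` A) a))) else 0%N.
have iI a b : ~ A a -> ~ A b -> i a = i b -> a = b.
  move=> Aa Ab; rewrite /i; case: pselect => // Aa'; case: pselect => // Ab'.
  by move=> /jI[].
(* The even rows of [g] serve [A]; the odd rows over the single element [a0] take in the finite
   complement, numbered by [i]. *)
pose h (x : nat * K) : K :=
  if `[< A x.2 >] then g (x.1.*2, x.2) else g ((pickle (x.1, i x.2)).*2.+1, a0).
exists h => -[n a] [m b]; rewrite /h /=.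
case: asboolP => Aa; case: asboolP => Ab e.
- have := gP (n.*2, a) Aa; rewrite e => /G4/(_ (gP (m.*2, b) Ab))[nm ->].
  by rewrite -(doubleK n) nm doubleK.
- have := gP (n.*2, a) Aa; rewrite e.
  move=> /G4/(_ (gP (_, a0) Aa0))[/(congr1 odd)].
  by rewrite /= !odd_double.
- have := gP (m.*2, b) Ab; rewrite -e.
  move=> /G4/(_ (gP (_, a0) Aa0))[/(congr1 odd)].
  by rewrite /= !odd_double.
- have := gP ((pickle (n, i a)).*2.+1, a0) Aa0; rewrite e.
  move=> /G4/(_ (gP (_, a0) Aa0))[/double_inj].
  move=> /(pcan_inj pickleK)[-> ii].
  by rewrite (iI _ _ Aa Ab ii).
Qed.

(** * Sets of size at most $2^\kappa$ *)

Section PowerCardinal.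
Variables (K : Type) (infK : infinite_set [set: K]).
Local Notation L := (set K).

Lemma embeds_seq_fun T : embeds (seq T) (nat -> option T).
Proof.
exists (fun s n => nth None (map Some s) n) => s t st.
have {}st n : nth None (map Some s) n = nth None (map Some t) n.
  exact: (congr1 (fun h => h n) st).
elim: s t st => [|x s IH] [|y t] st //; first by have := st 0%N.
  by have := st 0%N.
have [->] := st 0%N; rewrite (IH t) // => n; exact: (st n.+1).
Qed.

Lemma pow_set_nat_prod : embeds (set (nat * K)) L.
Proof. exact/embeds_set/embeds_nat_prod. Qed.

(** Currying gives $(2^\kappa)^{\aleph_0} = 2^{\aleph_0\cdot\kappa}$, and $\aleph_0\cdot\kappa =
    \kappa$. Products, sums, options and finite sequences reduce to this case. *)
Lemma pow_nat_fun T : embeds T L -> embeds (nat -> T) L.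
Proof.
move=> /(embeds_fun nat) h; apply: embeds_trans h _.
apply: embeds_trans pow_set_nat_prod.
exists (fun h => [set p | h p.1 p.2]) => h k hk; apply/funext => n.
apply/funext => a; exact: (congr1 (fun h => h (n, a)) hk).
Qed.

Lemma pow_nat_set : embeds (set nat) L.
Proof.
apply: embeds_set; by have [e [eI _]] := infinite_set_inj infK; exists e.
Qed.

Lemma pow_count (T : countType) : embeds T L.
Proof.
apply: embeds_trans (embeds_count T) _; apply: embeds_trans pow_nat_set.
by exists (fun n => [set n]) => n m nm; have : [set m] n by rewrite -nm.
Qed.

Lemma pow_count_set (T : countType) : embeds (set T) L.
Proof.
by apply: embeds_trans pow_nat_set; exact/embeds_set/embeds_count.
Qed.

Lemma pow_prod T U : embeds T L -> embeds U L -> embeds (T * U) L.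
Proof.
move=> hT hU; apply: embeds_trans (embeds_prod hT hU) _.
apply: embeds_trans (pow_nat_fun (embeds_refl L)).
exists (fun x n => if n is 0%N then x.1 else x.2) => -[a b] [c d] e.
have := congr1 (fun h => h 0%N) e; have := congr1 (fun h => h 1%N) e.
by move=> /= -> ->.
Qed.

Lemma pow_sum T U : embeds T L -> embeds U L -> embeds (T + U) L.
Proof.
move=> [f fI] [g gI]; apply: embeds_trans (pow_prod (pow_count bool)
  (embeds_refl L)).
exists (fun x => match x with inl t => (true, f t) | inr u => (false, g u) end).
by move=> [t|u] [t'|u'] //= [] => [/fI->|/gI->].
Qed.

Lemma pow_option T : embeds T L -> embeds (option T) L.
Proof.
move=> h; apply: embeds_trans (pow_sum h (pow_count unit)).
exists (fun x => if x is Some t then inl t else inr tt).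
by move=> [t|] [u|] //= [->].
Qed.

Lemma pow_seq T : embeds T L -> embeds (seq T) L.
Proof.
move=> h; apply: embeds_trans (embeds_seq_fun T) _.
exact/pow_nat_fun/pow_option.
Qed.

(** A real number is determined by its lower Dedekind cut in the rationals. *)
Lemma pow_real (R : realType) : embeds R L.
Proof.
apply: embeds_trans (pow_count_set rat).
exists (fun x => [set q : rat | ratr q < x]) => x y xy; apply/eqP.
rewrite -[_ == _]negbK; apply/negP; wlog: x y xy / x < y.
  move=> H; rewrite neq_lt => /orP[xly|ylx].
    by apply: (H x y) => //; rewrite neq_lt xly.
  by apply: (H y x) => //; rewrite neq_lt ylx.
move=> /rat_in_itvoo[q]; rewrite in_itv /= => /andP[xq qy] _.
have : [set q : rat | ratr q < x] q by rewrite xy.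
by move=> /(lt_trans xq); rewrite ltxx.
Qed.

Lemma pow_complex (R : realType) : embeds (Cplx R) L.
Proof.
apply: embeds_trans (pow_prod (pow_real R) (pow_real R)).
by exists (fun z : R[i]%C => (complex.Re z, complex.Im z)) => -[a b] [c d] [-> ->].
Qed.

End PowerCardinal.

(** * Compactness and connectedness *)

Section Compactness.
Variable T : topologicalType.

(** Directedness makes the traces of the [F i] on [A] a filter base, and a cluster point lies in
    every closed [F i]. Limits of stages, their fibres and joint ranges are all handled in this
    form. *)
Lemma compact_directed_bigcap (I : Type) (F : I -> set T) (A : set T) :
  compact A -> (forall i, closed (F i)) -> (forall i, A `&` F i !=set0) ->
  (forall i j, exists k, F k `<=` F i `&` F j) -> (exists i : I, True) ->
  exists2 x, A x & forall i, F i x.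
Proof.
move=> cA clF F0 dirF [i0 _].
pose G := filter_from [set: I] (fun i => A `&` F i).
have FG : ProperFilter G.
  apply: filter_from_proper; last by move=> i _; exact: F0.
  apply: filter_from_filter; first by exists i0.
  move=> i j _ _; have [k Fk] := dirF i j; exists k => //.
  by move=> x [Ax /Fk[Fi Fj]].
have [|x [Ax clx]] := cA G FG; first by exists i0 => // x [].
exists x => // i; apply: clF => U Ux.
have [|y [[_ Fy] Uy]] := clx (A `&` F i) U _ Ux; first by exists i.
by exists y.
Qed.

Lemma compact_finite_cover (U : T -> set T) : compact [set: T] ->
  (forall x, nbhs x (U x)) -> exists s : seq T, forall y, exists2 x, x \in s & U x y.
Proof.
move=> cT nU; apply: contrapT => nos.
pose F (s : seq T) := [set y | forall x, x \in s -> (~` (U x)°) y].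
have [||i j||x _ xF] := @compact_directed_bigcap (seq T) F setT cT.
- move=> s; rewrite (_ : F s = \bigcap_(x in [set` s]) ~` (U x)°) //.
  by apply: closed_bigI => x _; apply/open_closedC/open_interior.
- move=> s; apply: contrapT => F0; apply: nos; exists s => y.
  apply: contrapT => ny; apply: F0; exists y; split=> // x xs /interior_subset.
  by move=> Uy; apply: ny; exists x.
- exists (i ++ j) => y Fy; split=> x xs; apply: Fy; rewrite mem_cat xs //.
  by rewrite orbT.
- by exists [::].
by apply: (xF [:: x] x); [rewrite mem_head|exact: nU].
Qed.

Lemma connected_open_split (A U V : set T) : connected A -> open U -> open V ->
  A `<=` U `|` V -> A `&` U `&` V = set0 -> A `&` U !=set0 -> A `&` V = set0.
Proof.
move=> cA oU oV AUV AUV0 AU0.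
have AU : A `&` U = A.
  apply: cA => //; first by exists U.
  exists (~` V); first exact: open_closedC.
  apply/seteqP; split=> x [Ax].
    by move=> Ux; split=> // Vx; have : set0 x by rewrite -AUV0.
  by move=> nVx; split=> //; case: (AUV x Ax).
by rewrite -AU.
Qed.

(** Normality separates the two closed pieces by open sets that are disjoint in [T], not only in
    [A], so that they also split sets slightly larger than [A]. *)
Lemma connected_separation (R : realType) (A : set T) : hausdorff_space T ->
  compact [set: T] -> closed A -> ~ connected A -> exists U V, [/\ open U, open V,
  A `<=` U `|` V, U `&` V = set0 & A `&` U !=set0 /\ A `&` V !=set0].
Proof.
move=> hT cT clA /connectedPn[E [E0 AE [s1 s2]]].
have clE b : closed (E b).
  apply/closure_id/seteqP; split; first exact: subset_closure.
  move=> x cx; have : A x.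
    apply: clA; move: cx; apply: closureS; rewrite AE => y Ey.
    by case: b Ey; [right|left].
  rewrite AE; case: b cx => cx [] Ex //.
    by have : set0 x by rewrite -s2.
  by have : set0 x by rewrite -s1.
have dE : E false `&` E true = set0.
  by apply: separated_disjoint.
have /(normal_openP (R := R)) nT := compact_normal hT cT.
have [U [V [oU oV EU EV UV]]] := nT _ _ (clE false) (clE true) dE.
exists U, V; split=> //.
- by rewrite AE => x [/EU|/EV]; [left|right].
- split; [have [x Ex] := E0 false|have [x Ex] := E0 true]; exists x.
  + by split; [rewrite AE; left|exact: EU].
  + by split; [rewrite AE; right|exact: EV].
Qed.

(** If disjoint open sets split the intersection, compactness puts some [F i] inside their union,
    and this connected [F i] would be split already. *)
Lemma chain_bigcap_connected (R : realType) (I : Type) (F : I -> set T) :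
  hausdorff_space T -> compact [set: T] -> (exists i : I, True) ->
  (forall i, closed (F i)) -> (forall i, connected (F i)) ->
  (forall i j, exists k, F k `<=` F i `&` F j) ->
  connected (\bigcap_i F i).
Proof.
move=> hT cT i0 clF cF dirF; apply: contrapT.
move=> /(connected_separation R hT cT (closed_bigI (fun i _ => clF i))).
move=> [U [V [oU oV FUV UV [[u [Fu Uu]] [v [Fv Vv]]]]]].
have [i Fi] : exists i, F i `<=` U `|` V.
  apply: contrapT => noi.
  have [||i j||x _ xF] := @compact_directed_bigcap _
    (fun i => F i `&` ~` (U `|` V)) setT cT.
  - by move=> i; apply: closedI => //; apply/open_closedC/openU.
  - move=> i; apply: contrapT => F0; apply: noi; exists i => x Fx.
    by apply: contrapT => nUV; apply: F0; exists x.
  - by have [k Fk] := dirF i j; exists k => x [/Fk[? ?]].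
  - by [].
  have [i1 _] := i0; have [_ nUV] := xF i1; apply/nUV/FUV => i _.
  by have [] := xF i.
have : F i `&` V = set0.
  apply: (connected_open_split (cF i) oU oV Fi).
    by rewrite -setIA UV setI0.
  by exists u; split=> //; exact: Fu.
move=> FV0; have : (F i `&` V) v by split=> //; exact: Fv.
by rewrite FV0.
Qed.

End Compactness.

(** * Subspaces as types, and continuous images *)

Section SetType.
Variables (T : topologicalType) (A : set T).

Lemma set_val_continuous : continuous (set_val : A -> T).
Proof. exact: initial_continuous. Qed.

Lemma set_val_surj x : A x -> exists y : A, set_val y = x.
Proof. by move=> Ax; exists (SigSub (mem_set Ax)). Qed.

Lemma compact_set_type : compact A -> compact [set: A].
Proof.
move=> cA F FF _.
have FG : ProperFilter ((set_val : A -> T) @ F) by exact: fmap_proper_filter FF.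
have GA : ((set_val : A -> T) @ F) A.
  rewrite /= /fmap /=; have -> : set_val @^-1` A = [set: A].
    by apply/seteqP; split=> // y _; exact: set_valP.
  exact: filterT.
have [x [/set_val_surj[y <-] clx]] := cA _ FG GA.
exists y; split=> // B C FB; rewrite nbhsE => -[_ [[W oW <-] Oy] OC].
have FB' : ((set_val : A -> T) @ F) (set_val @` B).
  by apply: (@filterS _ F _ B) => // z Bz; exists z.
have [z [[b Bb <-] Ob]] := clx _ W FB' (open_nbhs_nbhs (conj oW Oy)).
by exists b; split=> //; exact: OC.
Qed.

Lemma connected_set_type : connected A -> connected [set: A].
Proof.
move=> cA B [b Bb] [_ [W oW <-]]; rewrite setTI => BO.
move=> [C' clC']; rewrite setTI => BC.
have : open (~` C') by exact: closed_openC.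
rewrite -BC => -[W' oW' BW'].
have h : A `&` W' = set0.
  apply: (connected_open_split cA oW oW').
  - move=> _ /set_val_surj[y <-].
    have [By|nBy] := pselect (B y); first by left; rewrite BO in By.
    right; have : (set_val @^-1` W') y by rewrite BW'.
    by [].
  - apply/seteqP; split=> // _ [[/set_val_surj[y <-] Oy] W'y].
    have : (~` B) y by rewrite -BW'.
    by apply; rewrite BO.
  - by exists (set_val b); split; [exact: set_valP|rewrite BO in Bb].
apply/seteqP; split=> // y _; apply: contrapT => nBy.
have : (~` B) y by []; rewrite -BW' => W'y.
have : (A `&` W') (set_val y) by split=> //; exact: set_valP.
by rewrite h.
Qed.

Lemma hausdorff_set_type : hausdorff_space T -> hausdorff_space A.
Proof.
move=> hT x y clxy; apply/val_inj/hT => U V Ux Vy.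
have [||z [Uz Vz]] := clxy (set_val @^-1` U) (set_val @^-1` V).
- exact: set_val_continuous.
- exact: set_val_continuous.
by exists (set_val z).
Qed.

End SetType.

Lemma connected_image (S T : topologicalType) (f : S -> T) (A : set S) :
  continuous f -> connected A -> connected (f @` A).
Proof.
move=> cf cA; apply: connected_continuous_connected => //.
exact: continuous_subspaceT.
Qed.

Lemma compact_image (S T : topologicalType) (f : S -> T) (A : set S) :
  continuous f -> compact A -> compact (f @` A).
Proof.
move=> cf cA; apply: continuous_compact => //.
exact: continuous_subspaceT.
Qed.

(** * Complex-valued functions *)

Section ComplexNumbers.
Variable R : realType.
Local Notation C := (Cplx R).
Implicit Types z w : C.

Definition Cre z : R := complex.Re z.
Definition Cim z : R := complex.Im z.
Definition Cmk (x y : R) : C := Complex x y.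
(** The norm of [Cplx R] is itself complex-valued; this is the modulus as a real number, in the form
    used by [cnorm] on [CX]. *)
Definition Cnm z : R := complex.Re `|z|.

Lemma CmkK z : Cmk (Cre z) (Cim z) = z.
Proof. by case: z. Qed.

Lemma Cnm_norm z : `|z| = Cmk (Cnm z) 0.
Proof. by rewrite /Cnm normc_def. Qed.

Lemma CnmE z : Cnm z = Num.sqrt (Cre z ^+ 2 + Cim z ^+ 2).
Proof. by rewrite /Cnm normc_def. Qed.

Lemma Cnm_ge0 z : 0 <= Cnm z.
Proof. by rewrite CnmE sqrtr_ge0. Qed.

Lemma CnmM z w : Cnm (z * w) = Cnm z * Cnm w.
Proof.
by rewrite {1}/Cnm normrM !Cnm_norm /= /Cmk mul0r subr0.
Qed.

Lemma CnmD z w : Cnm (z + w) <= Cnm z + Cnm w.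
Proof.
have := ler_normD z w; rewrite !Cnm_norm => h.
have : Cmk (Cnm (z + w)) 0 <= Cmk (Cnm z + Cnm w) (0 + 0) by [].
by rewrite addr0 lecR.
Qed.

Lemma CnmN z : Cnm (- z) = Cnm z.
Proof. by rewrite /Cnm normrN. Qed.

Lemma CnmB z w : Cnm (z - w) = Cnm (w - z).
Proof. by rewrite -opprB CnmN. Qed.

Lemma Cnm0 : Cnm 0 = 0.
Proof. by rewrite /Cnm normr0. Qed.

Lemma Cnm1 : Cnm 1 = 1.
Proof. by rewrite /Cnm normr1. Qed.

Lemma Cnm_eq0 z : Cnm z = 0 -> z = 0.
Proof. by move=> z0; apply/normr0_eq0; rewrite Cnm_norm z0. Qed.

Lemma Cnm_sqr z : Cnm z ^+ 2 = Cre z ^+ 2 + Cim z ^+ 2.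
Proof. by rewrite CnmE sqr_sqrtr // addr_ge0 // sqr_ge0. Qed.

Lemma Cre_le z : `|Cre z| <= Cnm z.
Proof.
rewrite -[Cnm z]ger0_norm ?Cnm_ge0 // -ler_sqr ?nnegrE // !real_normK
  ?num_real // Cnm_sqr.
by rewrite lerDl sqr_ge0.
Qed.

Lemma Cim_le z : `|Cim z| <= Cnm z.
Proof.
rewrite -[Cnm z]ger0_norm ?Cnm_ge0 // -ler_sqr ?nnegrE // !real_normK
  ?num_real // Cnm_sqr.
by rewrite lerDr sqr_ge0.
Qed.

Lemma Cnm_le z : Cnm z <= `|Cre z| + `|Cim z|.
Proof.
rewrite -[Cnm z]ger0_norm ?Cnm_ge0 // -ler_sqr ?nnegrE ?addr_ge0 //.
rewrite real_normK ?num_real // Cnm_sqr.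
rewrite -(real_normK (num_real (Cre z))) -(real_normK (num_real (Cim z))).
have := mulr_ge0 (normr_ge0 (Cre z)) (normr_ge0 (Cim z)); lra.
Qed.

Lemma Cnm_dist z w : `|Cnm z - Cnm w| <= Cnm (z - w).
Proof.
have := CnmD (z - w) w; have := CnmD (w - z) z; rewrite !subrK (CnmB w z).
by move=> h1 h2; rewrite ler_norml; apply/andP; split; lra.
Qed.

Lemma continuous_CP (X : topologicalType) (f : X -> C) : continuous f <->
  forall x (e : R), 0 < e -> \forall y \near x, Cnm (f x - f y) < e.
Proof.
split=> [cf x e e0|h x].
  have /cvgrPdist_lt/(_ (Cmk e 0)) := cf x.
  have -> : 0 < Cmk e 0 by rewrite ltcR.
  by move=> /(_ isT); apply: filterS => y; rewrite Cnm_norm ltcR.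
apply/cvgrPdist_lt => e e0.
have e'0 : 0 < Cre e by move: e0; rewrite ltcE => /andP[_].
have eE : e = Cmk (Cre e) 0.
  by rewrite -{1}(CmkK e); move: e0; rewrite ltcE /= => /andP[/eqP + _] => <-.
by apply: filterS (h x _ e'0) => y; rewrite eE Cnm_norm ltcR.
Qed.

Section Continuity.
Variable X : topologicalType.

Lemma continuous_RP (f : X -> R) : continuous f <->
  forall x (e : R), 0 < e -> \forall y \near x, `|f x - f y| < e.
Proof.
by split=> [cf x e e0|h x]; [have /cvgrPdist_lt/(_ e e0) := cf x|
  apply/cvgrPdist_lt => e; exact: h].
Qed.

Lemma continuous_dom (f : X -> C) (g : X -> R) : continuous f ->
  (forall x y, `|g x - g y| <= Cnm (f x - f y)) -> continuous g.
Proof.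
move=> /continuous_CP cf fg; apply/continuous_RP => x e e0.
by apply: filterS (cf x e e0) => y; exact/le_lt_trans.
Qed.

Lemma continuous_Cre (f : X -> C) : continuous f -> continuous (fun x => Cre (f x)).
Proof.
move=> /continuous_dom; apply => x y; apply: le_trans (Cre_le _).
by case: (f x) (f y) => a b [c d].
Qed.

Lemma continuous_Cim (f : X -> C) : continuous f -> continuous (fun x => Cim (f x)).
Proof.
move=> /continuous_dom; apply => x y; apply: le_trans (Cim_le _).
by case: (f x) (f y) => a b [c d].
Qed.

Lemma continuous_Cnm (f : X -> C) : continuous f -> continuous (fun x => Cnm (f x)).
Proof. by move=> /continuous_dom; apply => x y; exact: Cnm_dist. Qed.

Lemma continuous_Cmk (f g : X -> R) : continuous f -> continuous g ->
  continuous (fun x => Cmk (f x) (g x)).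
Proof.
move=> /continuous_RP cf /continuous_RP cg; apply/continuous_CP => x e e0.
have e2 : 0 < e / 2 by rewrite divr_gt0.
have cfx := cf x _ e2; have cgx := cg x _ e2; near=> y.
apply: le_lt_trans (Cnm_le _) _; rewrite [e in _ < e]splitr.
by apply: ltrD; near: y.
Unshelve. all: by end_near. Qed.

Lemma compact_Cnm_bounded (f : X -> C) : compact [set: X] -> continuous f ->
  exists2 M : R, 0 <= M & forall x, Cnm (f x) <= M.
Proof.
move=> cX cf; have [X0|X0] := pselect ([set: X] !=set0); last first.
  by exists 0 => // x; exfalso; apply: X0; exists x.
have [|c _ h] := compact_EVT_max X0 cX (f := fun x => Cnm (f x)).
  exact/continuous_subspaceT/continuous_Cnm.
by exists (Cnm (f c)) => [|x]; [exact: Cnm_ge0|by apply: h; rewrite inE].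
Qed.

Lemma closed_eq_Cplx (f g : X -> C) : continuous f -> continuous g ->
  closed [set x | f x = g x].
Proof.
move=> cf cg; have -> : [set x | f x = g x] =
    (fun x => Cnm (f x - g x)) @^-1` [set 0].
  apply/seteqP; split=> x /=; first by move=> ->; rewrite subrr Cnm0.
  by move=> /Cnm_eq0/eqP; rewrite subr_eq0 => /eqP.
apply: preimage_closed; last exact: closed_eq.
move=> x _; apply: continuous_Cnm => {}x; apply: cvgB; [exact: cf|exact: cg].
Qed.

End Continuity.

Section SupNorm.
Variables (X : topologicalType).
Hypothesis cX : compact [set: X].
Hypothesis X0 : [set: X] !=set0.

(** Compactness bounds the set under [sup] and [X0] makes it nonempty, so that [sup] is a genuine
    supremum. *)
Lemma CX_norm_leP (f : CX R X) (M : R) :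
  (cnorm f <= M) <-> forall x, Cnm ((f : continuousType X C) x) <= M.
Proof.
have [B B0 fB] := compact_Cnm_bounded cX (@cts_fun _ _ (f : continuousType X C)).
split=> [h x|h].
  apply: le_trans h; apply: ub_le_sup; last by exists x.
  by exists B => _ [y _ <-]; exact: fB.
by apply: ge_sup; [have [x _] := X0; exists (Cnm ((f : continuousType X C) x)), x|
  move=> _ [y _ <-]; exact: h].
Qed.

Lemma CX_ext (f g : CX R X) : (forall x, (f : continuousType X C) x =
  (g : continuousType X C) x) -> f = g.
Proof. by move=> fg; apply/continuousEP => x. Qed.

End SupNorm.
End ComplexNumbers.

(** * Gelfand duality *)

Section Gelfand.
Variable R : realType.
Local Notation C := (Cplx R).

Definition evC (X : topologicalType) (f : CX R X) (x : X) : C :=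
  (f : continuousType X C) x.

Lemma continuous_evC (X : topologicalType) (f : CX R X) : continuous (evC f).
Proof. exact: (@cts_fun _ _ (f : continuousType X C)). Qed.

Definition mkC (X : topologicalType) (f : X -> C) (cf : continuous f) : CX R X :=
  mkcts cf.

Lemma urysohn_point (Y : topologicalType) (A : set Y) (y : Y) :
  compact [set: Y] -> hausdorff_space Y -> closed A -> ~ A y ->
  exists2 g : CX R Y, evC g y = 1 & forall a, A a -> evC g a = 0.
Proof.
move=> cY hY clA nAy.
have [|||g [cg g0 g1 _]] := urysohn_ext_itv (R := R) (compact_normal hY cY) clA
    (B := [set y]) (x := 0) (y := 1) _ _ _.
- exact/accessible_closed_set1/hausdorff_accessible.
- by apply/seteqP; split=> // x [Ax /= xy]; apply: nAy; rewrite -xy.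
- exact: ltr01.
pose G := mkC (continuous_Cmk cg (@cst_continuous Y R 0)).
have GE x : evC G x = Cmk (g x) 0 by [].
exists G; first by rewrite GE (g1 (g y)) //; exists y.
by move=> a Aa; rewrite GE (g0 (g a)) //; exists a.
Qed.

Section Character.
Variables Y Z : topologicalType.
Hypotheses (cY : compact [set: Y]) (hY : hausdorff_space Y).
Hypotheses (cZ : compact [set: Z]) (Z0 : [set: Z] !=set0) (Y0 : [set: Y] !=set0).
Variable f : CX R Y -> CX R Z.
Hypothesis ef : cembedding f.

(* Characters are evaluations: otherwise finitely many elements of the kernel
   have no common zero, and the sum of their squared moduli is invertible. *)
Lemma character_evaluation (z : Z) :
  exists y, forall g, evC (f g) z = evC g y.
Proof.
case: ef => [[f0 f1] fD fM fZ [fS fN]].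
apply: contrapT => noy.
have /choice[k kP] : forall y, exists k : CX R Y, evC (f k) z = 0 /\ evC k y <> 0.
  move=> y; have /existsNP[g gP] : ~ (forall g, evC (f g) z = evC g y).
    by move=> h; apply: noy; exists y.
  (* Subtracting its value under the character puts [g] in the kernel, and the difference does not
     vanish at [y]. *)
  exists (cadd g (cscale (- evC (f g) z) (cone (CX R Y)))); split.
    rewrite fD fZ f1 -[LHS]/(evC (f g) z + - evC (f g) z * 1).
    by rewrite mulr1 subrr.
  rewrite -[evC _ _]/(evC g y + - evC (f g) z * 1) mulr1 => /eqP.
  by rewrite subr_eq0 => /eqP/esym.
have [|s sP] := compact_finite_cover (U := fun y => [set x | evC (k y) x <> 0]) cY.
  move=> y; apply: open_nbhs_nbhs; split; last exact: (kP y).2.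
  have := @closed_eq_Cplx R _ (evC (k y)) _ (@continuous_evC _ (k y))
    (@cst_continuous _ _ 0).
  by move=> /closed_openC.
have [h [fh hr hp]] : exists h : CX R Y, [/\ evC (f h) z = 0,
    forall x, Cim (evC h x) = 0 /\ 0 <= Cre (evC h x) &
    forall x y, y \in s -> evC (k y) x <> 0 -> 0 < Cre (evC h x)].
  elim: s {sP} => [|y s [h [fh hr hp]]].
    by exists (czero _); split=> //; rewrite f0.
  (* The squared modulus of [k y] is nonnegative and remains in the kernel, which is an ideal. *)
  pose q := cmul (k y) (cstar (k y)).
  have qE x : Cim (evC q x) = 0 /\ Cre (evC q x) = Cnm (evC (k y) x) ^+ 2.
    have -> : evC q x = `|evC (k y) x| ^+ 2 by rewrite normCK.
    by rewrite Cnm_norm !expr2 /Cim /Cre /Cmk /= !(mulr0, mul0r, addr0, subr0).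
  exists (cadd h q); split.
  - rewrite fD fM -[LHS]/(evC (f h) z + evC (f (k y)) z * evC (f (cstar (k y))) z).
    by rewrite fh (kP y).1 mul0r addr0.
  - move=> x; have [hi hre] := hr x; have [qi qr] := qE x.
    have -> : evC (cadd h q) x = evC h x + evC q x by [].
    move: hi hre qi qr; case: (evC h x) (evC q x) => [a b] [c d] /= -> ha -> ->.
    by rewrite addr0 addr_ge0 // exprn_ge0 // Cnm_ge0.
  - move=> x y'; have [hi hre] := hr x; have [qi qr] := qE x.
    have -> : Cre (evC (cadd h q) x) = Cre (evC h x) + Cre (evC q x).
      rewrite -[evC (cadd h q) x]/(evC h x + evC q x).
      by case: (evC h x) (evC q x) => [a b] [c d].
    rewrite inE => /orP[/eqP -> kx|ys kx].
      rewrite qr ltr_wpDl // exprn_gt0 // lt_def Cnm_ge0 andbT.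
      by apply/eqP => /Cnm_eq0.
    by rewrite ltr_pwDl ?qr ?exprn_ge0 ?Cnm_ge0 //; exact: hp kx.
have hn0 x : evC h x != 0.
  by have [y ys kx] := sP x; have := hp x y ys kx; case: eqP => // ->; rewrite ltxx.
have ci : continuous (fun x => (evC h x)^-1).
  by move=> x; apply: cvgV => //; exact: continuous_evC.
have : evC (f (cmul h (mkC ci))) z = 1.
  have -> : cmul h (mkC ci) = cone _; last by rewrite f1.
  apply: CX_ext => x; rewrite -[LHS]/(evC h x * (evC h x)^-1).
  by rewrite divff.
rewrite fM -[LHS]/(evC (f h) z * _) fh mul0r => /eqP.
by rewrite eq_sym oner_eq0.
Qed.

(** Continuity of [pi] is tested on Urysohn functions. Surjectivity comes from norm preservation: a
    function vanishing on the closed range of [pi] is sent to a function of norm 0. *)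
Lemma gelfand : exists pi : Z -> Y, [/\ continuous pi, forall y, exists z, pi z = y &
  forall g z, evC (f g) z = evC g (pi z)].
Proof.
have /choice[pi piP] := character_evaluation.
have cpi : continuous pi.
  move=> z U; rewrite nbhsE => -[V [oV Vz] VU].
  have [|g g1 g0] := @urysohn_point _ (~` V) (pi z) cY hY (open_closedC oV); first by [].
  have := iffLR (continuous_CP _) (@continuous_evC _ (f g)) z 1 ltr01.
  apply: filterS => z' h; apply: VU; apply: contrapT => nV.
  by move: h; rewrite !piP g1 g0 // subr0 Cnm1 ltxx.
exists pi; split=> // y.
apply: contrapT => ny.
have clA : closed (range pi) by apply: compact_closed hY _; exact: compact_image cpi cZ.
have [|g g1 g0] := @urysohn_point _ _ y cY hY clA.
  by move=> [z _ zy]; apply: ny; exists z.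
have [_ _ _ _ [_ fN]] := ef.
have : cnorm g <= 0.
  rewrite -fN; apply/(CX_norm_leP cZ Z0) => z.
  by rewrite -[X in Cnm X]/(evC (f g) z) piP g0 ?Cnm0 //; exists z.
move/(CX_norm_leP cY Y0)/(_ y); rewrite -[X in Cnm X]/(evC g y) g1 Cnm1.
by rewrite ler10.
Qed.

End Character.
End Gelfand.

(** * Existential closedness from realized types *)

Section Formulas.
Variable R : realType.
Local Notation C := (Cplx R).

Lemma cembedding_comp (M N P : cstruct R) (f : M -> N) (g : N -> P) :
  cembedding f -> cembedding g -> cembedding (g \o f).
Proof.
move=> [[f0 f1] fD fM fZ [fS fN]] [[g0 g1] gD gM gZ [gS gN]].
split=> [|a b|a b|l a|] /=; first by rewrite f0 f1.
- by rewrite fD gD.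
- by rewrite fM gM.
- by rewrite fZ gZ.
- by split=> a /=; rewrite ?fS ?gS ?gN.
Qed.

Lemma term_val_embedding (M N : cstruct R) (f : M -> N) V (e : V -> M)
    (t : cterm R V) : cembedding f -> term_val (f \o e) t = f (term_val e t).
Proof.
move=> [[f0 f1] fD fM fZ [fS _]].
elim: t => [v|||t IHt u IHu|t IHt u IHu|l t IHt|t IHt] //=.
- by rewrite IHt IHu fD.
- by rewrite IHt IHu fM.
- by rewrite IHt fZ.
- by rewrite IHt fS.
Qed.

Lemma qf_val_embedding (M N : cstruct R) (f : M -> N) V (e : V -> M)
    (phi : qf_formula R V) : cembedding f -> qf_val (f \o e) phi = qf_val e phi.
Proof.
move=> ef; elim: phi => [t|n u cu psi IH] /=.
  by rewrite term_val_embedding //; case: ef => _ _ _ _ [_ ->].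
by congr u; apply/rowP => i; rewrite !mxE IH.
Qed.

Section SameRange.
Variables (X Y : topologicalType) (V : Type).
Variables (e : V -> CX R X) (e' : V -> CX R Y).
Hypothesis XY : forall x, exists y, forall v, evC (e v) x = evC (e' v) y.
Hypothesis YX : forall y, exists x, forall v, evC (e v) x = evC (e' v) y.

Lemma term_val_pointwise (t : cterm R V) x y :
  (forall v, evC (e v) x = evC (e' v) y) ->
  evC (term_val e t) x = evC (term_val e' t) y.
Proof.
move=> xy; elim: t => [v|||t IHt u IHu|t IHt u IHu|l t IHt|t IHt] //=.
- transitivity (evC (term_val e t) x + evC (term_val e u) x) => //.
  by rewrite IHt IHu.
- transitivity (evC (term_val e t) x * evC (term_val e u) x) => //.
  by rewrite IHt IHu.
- by transitivity (l * evC (term_val e t) x) => //; rewrite IHt.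
- by transitivity (Num.conj (evC (term_val e t) x)) => //; rewrite IHt.
Qed.

(** Terms are evaluated pointwise, so each norm in the formula is a supremum over the joint range of
    the variables. *)
Lemma qf_val_same_range (phi : qf_formula R V) : qf_val e phi = qf_val e' phi.
Proof.
elim: phi => [t|n u cu psi IH] /=; last by congr u; apply/rowP => i; rewrite !mxE IH.
congr sup; apply/seteqP; split=> _ [x _ <-].
  have [y xy] := XY x; exists y => //.
  rewrite -[LHS]/(Cnm (evC (term_val e' t) y)).
  by rewrite -[RHS]/(Cnm (evC (term_val e t) x)) (term_val_pointwise t xy).
have [w xy] := YX x; exists w => //.
rewrite -[LHS]/(Cnm (evC (term_val e t) w)).
by rewrite -[RHS]/(Cnm (evC (term_val e' t) x)) (term_val_pointwise t xy).
Qed.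

End SameRange.

(** Gelfand duality turns an extension of $C(X)$ into a continuum mapping onto [X]. The two infima
    agree because they are taken over the same set of values. *)
Lemma realizing_existentially_closed (X : topologicalType) : continuum X ->
  (forall (Z : topologicalType) (pi : Z -> X), continuum Z -> continuous pi ->
    (forall x, exists z, pi z = x) ->
    forall m k (a : 'I_m -> CX R Z) (b : 'I_k -> CX R X),
    exists a' : 'I_m -> CX R X,
    (forall x, exists z, (forall i, evC (a' i) x = evC (a i) z) /\
                         (forall j, evC (b j) x = evC (b j) (pi z))) /\
    (forall z, exists x, (forall i, evC (a' i) x = evC (a i) z) /\
                         (forall j, evC (b j) x = evC (b j) (pi z)))) ->
  existentially_closed (CX R X).
Proof.
move=> contX real; split.
  by exists X => //; exists id; [split|exists id].
move=> N f [Z contZ [h eh [g hK gK]]] ef m k phi r b.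
have [X0 cX hX _] := contX; have [Z0 cZ hZ _] := contZ.
have ehf := cembedding_comp ef eh.
have [pi [cpi pis piE]] := gelfand cX hX cZ Z0 X0 ehf.
have hN c : cnorm (h c) = cnorm c by case: eh => _ _ _ _ [].
have fN c : cnorm (f c) = cnorm c by case: ef => _ _ _ _ [].
congr inf; apply/seteqP; split=> _ [a /= ar <-].
  exists (fun i => f (a i)) => /=; first by move=> i; rewrite fN; exact: ar.
  rewrite -(qf_val_embedding _ phi ef); congr (qf_val _ phi).
  by apply/funext => -[].
have [a' [XZ ZX]] := real Z pi contZ cpi pis m k (h \o a) b.
pose e v := match v with inl i => a' i | inr j => b j end.
pose e' v := match v with inl i => a i | inr j => f (b j) end.
have sameX x : exists z, forall v, evC (e v) x = evC ((h \o e') v) z.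
  have [z [az bz]] := XZ x; exists z => -[i|j] /=; first exact: az.
  by rewrite bz -piE.
have sameZ z : exists x, forall v, evC (e v) x = evC ((h \o e') v) z.
  have [x [ax bx]] := ZX z; exists x => -[i|j] /=; first exact: ax.
  by rewrite bx -piE.
exists a'.
  (* The norm of a variable is itself a quantifier-free formula, so equal joint ranges keep the
     witness in its ball. *)
  move=> i; have E : cnorm (a' i) = cnorm (a i).
    exact: etrans (qf_val_same_range sameX sameZ (TNorm (TVar R (inl i))))
      (qf_val_embedding e' (TNorm (TVar R (inl i))) eh).
  exact: (eq_ind_r (fun x => x <= (r i)%:R) (ar i) E).
by rewrite -(qf_val_embedding e' phi eh) -(qf_val_same_range sameX sameZ).
Qed.

End Formulas.

(** * Bases and functions from a separating family *)

Section SeparatingFamily.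
Variables (R : realType) (X : topologicalType) (L : choiceType) (c : L -> X -> R).
Hypothesis cX : compact [set: X].
Hypothesis cc : forall l, continuous (c l).
Hypothesis csep : forall x y, (forall l, c l x = c l y) -> x = y.

Lemma near_crd x (s : seq L) (e : R) : 0 < e ->
  \forall y \near x, forall l, l \in s -> `|c l x - c l y| < e.
Proof.
move=> e0; elim: s => [|l s IH]; first by apply: nearW => y l; rewrite in_nil.
apply: filterS2 IH (iffLR (continuous_RP _) (@cc l) x e e0) => y ys yl k.
by rewrite inE => /orP[/eqP ->|/ys].
Qed.

(** On a compact space a separating family of continuous functions induces the topology: otherwise
    some point outside the interior of [U] would have the same coordinates as [x]. *)
Lemma separating_nbhs x (U : set X) : nbhs x U -> exists (s : seq L) (n : nat),
  forall y, (forall l, l \in s -> `|c l x - c l y| <= n.+1%:R^-1) -> U y.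
Proof.
move=> Ux; apply: contrapT => no.
pose F (p : seq L * nat) : set X :=
  [set y | (forall l, l \in p.1 -> `|c l x - c l y| <= p.2.+1%:R^-1) /\ (~` U°) y].
have [||[s n] [t m]||y _ yF] := @compact_directed_bigcap _ _ F _ cX.
- move=> [s n]; have -> : F (s, n) = (\bigcap_(l in [set` s])
    [set y | `|c l x - c l y| <= n.+1%:R^-1]) `&` ~` U° by [].
  apply: closedI; last exact/open_closedC/open_interior.
  apply: closed_bigI => l _.
  have -> : [set y | `|c l x - c l y| <= n.+1%:R^-1] =
    (fun y => `|c l x - c l y|) @^-1` [set r | r <= n.+1%:R^-1] by [].
  apply: preimage_closed; last exact: closed_le.
  move=> y _; apply: cvg_norm; apply: cvgB; [exact: cvg_cst|exact: cc].
- move=> [s n]; apply: contrapT => F0; apply: no; exists s, n => y yP.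
  by apply: contrapT => nU; apply: F0; exists y; split=> //; split=> // /interior_subset.
- exists (s ++ t, maxn n m) => y [/= yP nU]; split; split=> // l ls.
    apply: le_trans (yP l _) _; first by rewrite mem_cat ls.
    by rewrite lef_pV2 ?posrE ?ltr0n // ler_nat ltnS leq_maxl.
  apply: le_trans (yP l _) _; first by rewrite mem_cat ls orbT.
  by rewrite lef_pV2 ?posrE ?ltr0n // ler_nat ltnS leq_maxr.
- by exists ([::], 0%N).
have xy : x = y.
  apply: csep => l; apply/eqP; rewrite -subr_eq0 -normr_le0 leNgt; apply/negP.
  move=> /ltr_add_invr[k]; rewrite add0r => h.
  have [/(_ l)] := yF ([:: l], k); rewrite mem_head /= => /(_ isT) /(lt_le_trans h).
  by rewrite ltxx.
have [_] := yF ([::], 0%N); apply; rewrite -xy; exact: Ux.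
Qed.

Definition code : Type := (seq (L * rat) * nat)%type.

Definition code_set (k : code) : set X :=
  [set y | forall p, p \in k.1 -> `|c p.1 y - ratr p.2| < k.2.+1%:R^-1].

Lemma open_code_set k : open (code_set k).
Proof.
case: k => s n; rewrite openE => x xs; rewrite /interior.
elim: s xs => [|p s IH] xs; first by apply: nearW => y p; rewrite in_nil.
have := IH (fun q qs => xs q (mem_behead (s := p :: s) qs)).
have h := xs p (mem_head _ _).
have h' : 0 < n.+1%:R^-1 - `|c p.1 x - ratr p.2| by rewrite subr_gt0.
have := iffLR (continuous_RP _) (@cc p.1) x _ h'.
apply: filterS2 => y yp ys q; rewrite inE => /orP[/eqP ->|/ys //].
have -> : c p.1 y - ratr p.2 = (c p.1 x - ratr p.2) - (c p.1 x - c p.1 y) by ring.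
by apply: le_lt_trans (ler_normB _ _) _; rewrite -ltrBrDl.
Qed.

Lemma code_set_nbhs x (U : set X) : nbhs x U ->
  exists k, code_set k x /\ code_set k `<=` U.
Proof.
move=> /separating_nbhs[s [n sU]].
(* The radius is below half of $1/(n+1)$: the errors at [x] and at [y] add up. *)
have /choice[q qP] : forall l, exists q : rat, `|c l x - ratr q| < n.+1.*2.+1%:R^-1.
  move=> l; have : 0 < n.+1.*2.+1%:R^-1 :> R by rewrite invr_gt0 ltr0n.
  move: (_^-1) => e e0; have h : c l x < c l x + e by rewrite ltrDl.
  have [q] := rat_in_itvoo h; rewrite in_itv /= => /andP[q1 q2]; exists q.
  by rewrite ltr_norml; apply/andP; split; lra.
exists ([seq (l, q l) | l <- s], n.+1.*2); split.
  by move=> _ /mapP[l ls ->] /=; exact: qP.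
move=> y yk; apply: sU => l ls.
have := yk (l, q l) (map_f _ ls); have := qP l.
rewrite /= => h1 h2.
have -> : c l x - c l y = (c l x - ratr (q l)) - (c l y - ratr (q l)) by ring.
apply: le_trans (ler_normB _ _) _.
apply: le_trans (ltW (ltrD h1 h2)) _.
have : n.+1.*2.+1%:R^-1 <= n.+1%:R^-1 / 2 :> R.
  rewrite -invfM -natrM lef_pV2 ?posrE ?ltr0n ?muln_gt0 //.
  by rewrite ler_nat muln2 ltnW.
by move=> h; rewrite [leRHS]splitr lerD.
Qed.

Lemma basis_code_set : basis (range code_set).
Proof.
split=> [_ [k _ <-]|x U /code_set_nbhs[k [kx kU]]]; first exact: open_code_set.
by exists (code_set k) => //; split=> //; exists k.
Qed.

(** For each precision $1/(n+1)$, a finite cover by basic sets with one approximate value on each is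
    recorded; these countably many finite lists determine the function. *)
Lemma embeds_continuous : embeds (continuousType X (Cplx R))
  (nat -> seq (code * Cplx R)).
Proof.
have /choice[h hP] : forall f : continuousType X (Cplx R),
    exists h : nat -> seq (code * Cplx R),
    forall n, (forall y, exists2 p, p \in h n & code_set p.1 y) /\
      forall p y, p \in h n -> code_set p.1 y -> Cnm (f y - p.2) < n.+1%:R^-1.
  move=> f.
  suff /choice[h hP] : forall n, exists t : seq (code * Cplx R),
    (forall y, exists2 p, p \in t & code_set p.1 y) /\
      forall p y, p \in t -> code_set p.1 y -> Cnm (f y - p.2) < n.+1%:R^-1 by exists h.
  move=> n; have e0 : 0 < n.+1%:R^-1 :> R by rewrite invr_gt0 ltr0n.
  have /choice[k kP] : forall x, exists k, code_set k x /\
      code_set k `<=` [set y | Cnm (f x - f y) < n.+1%:R^-1].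
    move=> x; apply: code_set_nbhs.
    exact: (iffLR (continuous_CP _) (@cts_fun _ _ f) x _ e0).
  have [|s sP] := compact_finite_cover (U := fun x => code_set (k x)) cX.
    move=> x; apply: open_nbhs_nbhs; split; first exact: open_code_set.
    by case: (kP x).
  exists [seq (k x, f x) | x <- s]; split.
    by move=> y; have [x xs xy] := sP y; exists (k x, f x); first exact: map_f.
  by move=> _ y /mapP[x xs ->] /= ky; rewrite CnmB; exact: (kP x).2.
exists h => f g fg; apply/continuousEP => y; apply/eqP; rewrite -subr_eq0.
apply/eqP/Cnm_eq0/eqP; rewrite eq_le Cnm_ge0 andbT leNgt; apply/negP.
(* The same list approximates both functions, so their distance is below $2/(n+1)$; hence the choice
   of [n] from half the distance. *)
rewrite -(pmulr_rgt0 (x := 2^-1)) ?invr_gt0 ?ltr0n // => /ltr_add_invr[n].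
have [p pf py] := (hP f n).1 y.
have h1 := (hP f n).2 p y pf py; have h2 := (hP g n).2 p y.
rewrite -fg in h2; have {}h2 := h2 pf py; rewrite add0r => h3.
have := CnmD (f y - p.2) (p.2 - g y); rewrite addrA subrK (CnmB p.2) => h4.
by move: h1 h2 h3 h4; clear; move: (_^-1) => e; lra.
Qed.

End SeparatingFamily.

(** * The cube *)

Section Cube.
Variables (R : realType) (L : choiceType).
Local Notation C := (Cplx R).

Definition seg : topologicalType := set_type (`[-1, 1]%classic : set R).

Lemma seg0 : `[-1, 1]%classic (0 : R).
Proof. by rewrite /= in_itv /= lerN10 ler01. Qed.

Definition seg_of (r : R) : seg :=
  match pselect (`[-1, 1]%classic r) with
  | left h => SigSub (mem_set h)
  | right _ => SigSub (mem_set seg0)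
  end.

Definition seg_val (x : seg) : R := set_val x.

Lemma seg_ofK r : -1 <= r <= 1 -> seg_val (seg_of r) = r.
Proof.
move=> h; rewrite /seg_of; case: pselect => // nh; by exfalso; apply: nh.
Qed.

Lemma seg_valP x : -1 <= seg_val x <= 1.
Proof. by have := set_valP x; rewrite /= in_itv. Qed.

Lemma seg_val_inj : injective seg_val.
Proof. exact: val_inj. Qed.

Definition cube : topologicalType := prod_topology (fun _ : L => seg).

Definition crd (l : L) (x : cube) : R := seg_val (x l).

Lemma continuous_crd l : continuous (crd l).
Proof.
move=> x; apply: (@continuous_comp cube seg R (fun x : cube => x l) seg_val).
  exact: (@proj_continuous L (fun=> seg) l).
exact: set_val_continuous.
Qed.

Lemma crd_inj x y : (forall l, crd l x = crd l y) -> x = y.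
Proof. by move=> xy; apply/funext => l; apply/seg_val_inj/xy. Qed.

Lemma compact_cube : compact [set: cube].
Proof.
have := @tychonoff L (fun=> seg) (fun=> setT)
  (fun _ => compact_set_type (@segment_compact R (-1) 1)).
by rewrite (_ : [set f | _] = setT) //; apply/seteqP.
Qed.

Lemma hausdorff_cube : hausdorff_space cube.
Proof.
apply: (@hausdorff_product L (fun=> seg)) => _.
by apply: hausdorff_set_type; exact: Rhausdorff.
Qed.

Lemma continuous_to_cube (X : topologicalType) (f : X -> cube) :
  (forall l, continuous (fun x => crd l (f x))) -> continuous f.
Proof.
move=> cf x U /(separating_nbhs compact_cube continuous_crd crd_inj)[s [n sU]].
have e0 : 0 < n.+1%:R^-1 :> R by rewrite invr_gt0 ltr0n.
have := near_crd cf x s e0; apply: filterS => y ys; apply: sU => l ls.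
exact/ltW/ys.
Qed.

Definition agree (S : set L) (x y : cube) := forall l, S l -> x l = y l.

(** The projection to the coordinates in [S], realized inside the same cube by filling the others
    with 0. *)
Definition restr (S : set L) (x : cube) : cube :=
  fun l => if `[< S l >] then x l else seg_of 0.

Lemma agree_restr S x : agree S x (restr S x).
Proof. by move=> l Sl; rewrite /restr asboolT. Qed.

Lemma agree_sym S x y : agree S x y -> agree S y x.
Proof. by move=> xy l Sl; rewrite xy. Qed.

Lemma agree_trans S x y z : agree S x y -> agree S y z -> agree S x z.
Proof. by move=> xy yz l Sl; rewrite xy // yz. Qed.

Lemma agree_sub S S' x y : S `<=` S' -> agree S' x y -> agree S x y.
Proof. by move=> SS xy l /SS/xy. Qed.

Lemma restr_agree S x y : agree S x y -> restr S x = restr S y.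
Proof.
by move=> xy; apply/funext => l; rewrite /restr; case: asboolP => // /xy.
Qed.

Lemma restr_id S x : restr S (restr S x) = restr S x.
Proof. exact/restr_agree/agree_sym/agree_restr. Qed.

Lemma seg_val0 : seg_val (seg_of 0) = 0.
Proof. by rewrite seg_ofK // lerN10 ler01. Qed.

Lemma crd_restr S x l : crd l (restr S x) = if `[< S l >] then crd l x else 0.
Proof. by rewrite /crd /restr; case: asboolP => // _; rewrite seg_val0. Qed.

Lemma continuous_restr S : continuous (restr S).
Proof.
apply: continuous_to_cube => l; under eq_fun do rewrite crd_restr.
case: asboolP => _; [exact: continuous_crd|exact: cst_continuous].
Qed.

Lemma closed_agree S x : closed [set y | agree S x y].
Proof.
have -> : [set y | agree S x y] = \bigcap_(l in S) (crd l @^-1` [set crd l x]).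
  apply/seteqP; split=> y h l Sl; first by rewrite /= /crd h.
  by apply/seg_val_inj/esym; exact: h.
apply: closed_bigI => l _; apply: preimage_closed; last exact: closed_eq.
by move=> y _; exact: continuous_crd.
Qed.

(* Scaling the coordinates off [S] joins a point to its restriction inside
   the cylinder. *)
Lemma connected_cylinder S (W : set cube) : W `<=` range (restr S) ->
  connected W -> connected [set x | W (restr S x)].
Proof.
move=> WS cW.
have [[w Ww]|W0] := pselect (W !=set0); last first.
  rewrite (_ : mkset _ = set0); first exact: connected0.
  by apply/seteqP; split=> // x Wx; apply: W0; exists (restr S x).
have WrW x : W x -> restr S x = x by move=> /WS[y _ <-]; exact: restr_id.
(* Clamping [t] to $[0,1]$ defines the path on all of [R]; it runs from [restr S x] at 0 to [x] at
   1. *)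
pose h (x : cube) (t : R) : cube := fun l => if `[< S l >] then x l else
  seg_of (Num.max 0 (Num.min 1 t) * crd l x).
have t01 (t : R) : 0 <= Num.max 0 (Num.min 1 t) <= 1.
  by rewrite le_max lexx /= ge_max ler01 ge_min lexx.
have hr x t : restr S (h x t) = restr S x.
  by apply: restr_agree => l Sl; rewrite /h asboolT.
have hc x l t : crd l (h x t) =
    if `[< S l >] then crd l x else Num.max 0 (Num.min 1 t) * crd l x.
  rewrite /crd /h; case: asboolP => // _; apply: seg_ofK; rewrite -ler_norml.
  have /andP[t0 t1] := t01 t; rewrite normrM (ger0_norm t0).
  by rewrite mulr_ile1 // ler_norml; exact: seg_valP.
have ch x : continuous (h x).
  apply: continuous_to_cube => l; under eq_fun do rewrite hc.
  case: asboolP => _; first exact: cst_continuous.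
  move=> t; apply: cvgM; last exact: cvg_cst.
  apply: (@continuous_max R R (fun=> 0) (fun t => Num.min 1 t) t).
    exact: cvg_cst.
  by apply: continuous_min; [exact: cvg_cst|exact: cvg_id].
have h1 x : h x 1 = x.
  apply: crd_inj => l; rewrite hc; case: asboolP => // _.
  by rewrite minxx (max_idPr _) ?ler01 // mul1r.
have h0 x : h x 0 = restr S x.
  apply: crd_inj => l; rewrite hc crd_restr; case: asboolP => // _.
  by rewrite (min_idPr _) ?ler01 // maxxx mul0r.
have -> : [set x | W (restr S x)] = \bigcup_(x in [set x | W (restr S x)])
    (W `|` (h x @` [set: R])).
  apply/seteqP; split=> [x Wx|y [x Wx [Wy|[t _ <-]]]].
  - by exists x => //; right; exists 1 => //; rewrite h1.
  - by rewrite /= WrW.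
  - by rewrite /= hr.
apply: bigcup_connected.
  by exists w => x Wx; left.
move=> x Wx; apply: connectedU => //.
  by exists (restr S x); split=> //; exists 0 => //; rewrite h0.
apply: connected_image; first exact: ch.
by apply/connected_intervalP.
Qed.

End Cube.

(** * Stages *)

Section RationalBoxes.
Variable R : realType.
Local Notation C := (Cplx R).

(** Centres for the witnesses, centres for the parameters, and [n] for the radius $1/(n+1)$. The
    lengths of the lists say how many variables are constrained, so one countable type serves all
    finite arities. *)
Definition box : Type := (seq (rat * rat) * seq (rat * rat) * nat)%type.

Definition rational_point (q : seq (rat * rat)) (i : nat) : C :=
  Cmk (ratr (nth (0, 0) q i).1) (ratr (nth (0, 0) q i).2).

Definition in_box (k : box) (u v : nat -> C) : Prop :=
  (forall i, (i < size k.1.1)%N -> Cnm (u i - rational_point k.1.1 i) < k.2.+1%:R^-1) /\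
  (forall j, (j < size k.1.2)%N -> Cnm (v j - rational_point k.1.2 j) < k.2.+1%:R^-1).

Lemma invS_gt0 n : 0 < n.+1%:R^-1 :> R.
Proof. by rewrite invr_gt0 ltr0n. Qed.

Lemma rational_approx (z : C) (e : R) : 0 < e ->
  exists q : rat * rat, Cnm (z - Cmk (ratr q.1) (ratr q.2)) < e.
Proof.
move=> e0; have e2 : 0 < e / 2 by rewrite divr_gt0.
have approx (x : R) : exists q : rat, `|x - ratr q| < e / 2.
  have h : x < x + e / 2 by rewrite ltrDl.
  have [q] := rat_in_itvoo h; rewrite in_itv /= => /andP[q1 q2]; exists q.
  by rewrite ltr_norml; apply/andP; split; lra.
have [p hp] := approx (Cre z); have [q hq] := approx (Cim z).
exists (p, q); apply: le_lt_trans (Cnm_le _) _; rewrite [ltRHS]splitr.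
by move: hp hq; case: z => a b /= hp hq; exact: ltrD.
Qed.

Lemma rational_points_approx (u : nat -> C) m (e : R) : 0 < e ->
  exists2 q, size q = m & forall i, (i < m)%N -> Cnm (u i - rational_point q i) < e.
Proof.
move=> e0; have /choice[q qP] := fun i => rational_approx (u i) e0.
exists (mkseq q m); first exact: size_mkseq.
by move=> i im; rewrite /rational_point nth_mkseq //; exact: qP.
Qed.

(** Values approximable in every box are attained, since the joint range of a compact set is closed.
    This is how a set of boxes recovers a joint range exactly. *)
Lemma boxes_realized (T : topologicalType) (A : set T) (u v : nat -> T -> C)
    (a b : nat -> C) m k : compact A ->
  (forall i, continuous (u i)) -> (forall j, continuous (v j)) ->
  (forall q, size q.1.1 = m -> size q.1.2 = k -> in_box q a b ->
    exists2 x, A x & in_box q (u ^~ x) (v ^~ x)) ->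
  exists2 x, A x & (forall i, (i < m)%N -> u i x = a i) /\
                   (forall j, (j < k)%N -> v j x = b j).
Proof.
move=> cA cu cv h.
(* The radius is doubled because both the attained value and the target lie within $1/(n+1)$ of the
   rational centre. *)
pose D (w : nat -> T -> C) (c : nat -> C) m n : set T :=
  \bigcap_(i in `I_m) [set x | Cnm (w i x - c i) <= n.+1%:R^-1 + n.+1%:R^-1].
have clD w c m' n : (forall i, continuous (w i)) -> closed (D w c m' n).
  move=> cw; apply: closed_bigI => i _.
  rewrite -[X in closed X]/((fun x => Cnm (w i x - c i)) @^-1`
    [set r | r <= n.+1%:R^-1 + n.+1%:R^-1]).
  apply: preimage_closed; last exact: closed_le.
  move=> x _; apply: continuous_Cnm => {}x.
  by apply: cvgB; [exact: cw|exact: cvg_cst].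
have Dmono w c m' n n' : (n <= n')%N -> D w c m' n' `<=` D w c m' n.
  move=> nn x Dx i im; apply: le_trans (Dx i im) _.
  by apply: lerD; rewrite lef_pV2 ?posrE ?ltr0n // ler_nat ltnS.
have [||n n'||x Ax xD] := @compact_directed_bigcap _ _
  (fun n => D u a m n `&` D v b k n) _ cA.
- by move=> n; apply: closedI; exact: clD.
- move=> n; have [q1 s1 q1P] := rational_points_approx a m (invS_gt0 n).
  have [q2 s2 q2P] := rational_points_approx b k (invS_gt0 n).
  have [|x Ax [xu xv]] := h (q1, q2, n) s1 s2.
    by split=> /=; rewrite ?s1 ?s2.
  exists x; split=> //; split=> i im /=.
    have -> : u i x - a i = (u i x - rational_point q1 i) - (a i - rational_point q1 i).
      by ring.
    apply: le_trans (CnmD _ _) _; rewrite CnmN; apply/ltW/ltrD; last exact: q1P.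
    by apply: xu; rewrite /= s1.
  have -> : v i x - b i = (v i x - rational_point q2 i) - (b i - rational_point q2 i).
    by ring.
  apply: le_trans (CnmD _ _) _; rewrite CnmN; apply/ltW/ltrD; last exact: q2P.
  by apply: xv; rewrite /= s2.
- exists (maxn n n') => x [xu xv].
  by do 2!split; apply: Dmono; try eassumption; rewrite ?leq_maxl ?leq_maxr.
- by exists 0%N.
have fin w c m' i : (forall n, D w c m' n x) -> (i < m')%N -> w i x = c i.
  move=> Dx im; apply/eqP; rewrite -subr_eq0; apply/eqP/Cnm_eq0/eqP.
  rewrite eq_le Cnm_ge0 andbT leNgt; apply/negP.
  rewrite -(pmulr_rgt0 (x := 2^-1)) ?invr_gt0 ?ltr0n // => /ltr_add_invr[n].
  have := Dx n i im; rewrite /= add0r; clear.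
  by move: (n.+1%:R^-1) => e; lra.
exists x => //; split=> i; apply: fin => n; exact: (xD n).1 || exact: (xD n).2.
Qed.

End RationalBoxes.

Section Stages.
Variables (R : realType) (L : choiceType).
Local Notation C := (Cplx R).
Local Notation Q := (cube R L).

(* A task asks, given parameters, for witnesses such that the joint range of
   witnesses and parameters meets the prescribed boxes and no others. *)
Definition task : Type := ((nat -> continuousType Q C) * set box)%type.

Variable enc : task * (nat * bool) -> L.
Hypothesis encI : injective enc.
Variables (S0 : set L) (P0 : set Q).
Hypothesis S0_enc : forall t, ~ S0 (enc t).
Hypotheses (clP0 : closed P0) (cP0 : connected P0) (P00 : P0 !=set0).
Hypothesis satP0 : forall x y, agree S0 x y -> P0 x -> P0 y.

Definition depends_on (S : set L) (g : CX R Q) : Prop :=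
  forall x y, agree S x y -> evC g x = evC g y.

Lemma depends_on_sub S S' g : S `<=` S' -> depends_on S g -> depends_on S' g.
Proof. by move=> SS gS x y /(agree_sub SS); exact: gS. Qed.

Definition realizes (S : set L) (P : set Q) (t : task) : Prop :=
  (forall j, depends_on S (t.1 j)) /\ exists a : nat -> CX R Q,
  (forall i, depends_on S (a i)) /\ forall k, t.2 k <-> exists2 x, P x &
    in_box k (fun i => evC (a i) x) (fun j => evC (t.1 j) x).

(** The last clause says that the bonding map, the projection to the coordinates [S], is onto. *)
Definition stage_le (S : set L) (P : set Q) (S' : set L) (P' : set Q) : Prop :=
  [/\ S `<=` S', P' `<=` P & forall x, P x -> exists2 y, P' y & agree S x y].

(* [P] is the cylinder over the continuum of a stage, which lives in the
   coordinates [S]. *)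
Definition stage (S : set L) (P : set Q) : Prop :=
  [/\ closed P, connected P, forall x y, agree S x y -> P x -> P y,
      forall t c, S (enc (t, c)) -> realizes S P t & stage_le S0 P0 S P].

Lemma stage_le_refl S P : stage_le S P S P.
Proof. by split=> // x Px; exists x. Qed.

Lemma stage_le_trans S1 P1 S2 P2 S3 P3 : stage_le S1 P1 S2 P2 ->
  stage_le S2 P2 S3 P3 -> stage_le S1 P1 S3 P3.
Proof.
move=> [s12 p21 e12] [s23 p32 e23]; split.
- exact: subset_trans s12 s23.
- exact: subset_trans p32 p21.
- move=> x /e12[y /e23[z P3z yz] xy]; exists z => //.
  exact: agree_trans xy (agree_sub s12 yz).
Qed.

(** Witnesses and parameters read only coordinates in [S], and the bonding map is onto, so their
    joint range does not change. *)
Lemma realizes_le S P S' P' t : stage_le S P S' P' -> realizes S P t ->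
  realizes S' P' t.
Proof.
move=> [SS PP ext] [tS [a [aS aP]]]; split.
  by move=> j; exact: depends_on_sub (tS j).
exists a; split; first by move=> i; exact: depends_on_sub (aS i).
move=> k; split=> [/aP[x /ext[y P'y xy] xk]|[x /PP Px xk]]; last first.
  by apply/aP; exists x.
exists y => //; case: xk => xa xt; split=> i ik.
  by rewrite -(aS i _ _ xy); exact: xa.
by rewrite -(tS i _ _ xy); exact: xt.
Qed.

Lemma stage0 : stage S0 P0.
Proof. by split=> // [t c /S0_enc//|]; exact: stage_le_refl. Qed.

Lemma stage_nonempty S P : stage S P -> P !=set0.
Proof.
by move=> [_ _ _ _ [_ _ ext]]; have [x /ext[y Py _]] := P00; exists y.
Qed.

(** The inverse limit of the chain: coordinates are united and cylinders intersected. For the empty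
    chain the initial stage is the bound. *)
Lemma stage_chain (A : set (set L * set Q)) : (forall s, A s -> stage s.1 s.2) ->
  total_on A (fun s t => stage_le s.1 s.2 t.1 t.2) ->
  exists s, stage s.1 s.2 /\ forall t, A t -> stage_le t.1 t.2 s.1 s.2.
Proof.
move=> Ast Atot; have [[s0 As0]|A0] := pselect (A !=set0); last first.
  exists (S0, P0); split; first exact: stage0.
  by move=> t At; exfalso; apply: A0; exists t.
pose S := \bigcup_(s in A) s.1; pose P := \bigcap_(s in A) s.2.
have PE : P = \bigcap_(s : A) (set_val s).2.
  apply/seteqP; split=> x Px s; last by move=> As; exact: (Px (SigSub (mem_set As))).
  by move=> _; apply: Px; exact: set_valP.
have i0 : exists i : A, True by exists (SigSub (mem_set As0)).
have dirA (i j : A) : exists k : A,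
    stage_le (set_val i).1 (set_val i).2 (set_val k).1 (set_val k).2 /\
    stage_le (set_val j).1 (set_val j).2 (set_val k).1 (set_val k).2.
  have [ij|ji] := Atot _ _ (set_valP i) (set_valP j).
    by exists j; split=> //; exact: stage_le_refl.
  by exists i; split=> //; exact: stage_le_refl.
have stg (i : A) := Ast _ (set_valP i).
have clP : closed P by apply: closed_bigI => s /Ast[].
have up s : A s -> stage_le s.1 s.2 S P.
  move=> As; split=> [l sl|x Px|x sx]; [by exists s|exact: Px|].
  (* The points over [x] in the members of the chain form a directed family of nonempty closed sets,
     so some point over [x] survives to the limit. *)
  have [||i j||y _ yF] := @compact_directed_bigcap _ A
    (fun t => (set_val t).2 `&` [set y | agree s.1 x y]) _ (@compact_cube R L).
  - move=> t; apply: closedI; last exact: closed_agree.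
    by have [] := stg t.
  - move=> t; have [[_ _ ext]|[_ ts _]] := Atot _ _ As (set_valP t).
      by have [y ty xy] := ext x sx; exists y.
    by exists x; split=> //; split=> //; exact: ts.
  - have [k [[_ ki _] [_ kj _]]] := dirA i j; exists k => y [ky xy].
    by do 2!split=> //; [exact: ki|exact: kj].
  - by [].
  exists y; first by rewrite PE => i _; have [] := yF i.
  by have [i _] := i0; have [_] := yF i.
exists (S, P); split=> //=; split=> //.
- rewrite PE; apply: (chain_bigcap_connected R (@hausdorff_cube R L)
    (@compact_cube R L)) => //.
  + by move=> i; have [] := stg i.
  + by move=> i; have [] := stg i.
  + move=> i j; have [k [[_ ki _] [_ kj _]]] := dirA i j.
    by exists k => y ky; split; [exact: ki|exact: kj].
- move=> x y xy Px s As; have [_ _ sat _ _] := Ast _ As.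
  by apply: sat (Px _ As) => l sl; apply: xy; exists s.
- move=> t c [s As sc]; have [_ _ _ rl _] := Ast _ As.
  exact: realizes_le (up _ As) (rl _ _ sc).
- have [_ _ _ _ le0] := Ast _ As0; exact: stage_le_trans le0 (up _ As0).
Qed.

(** Inclusion of coordinate sets is all that is used of maximality: realizing a further task would
    bring its reserved coordinates into [S]. *)
Lemma maximal_stage : exists S P, stage S P /\
  forall S' P', stage S' P' -> stage_le S P S' P' -> S' `<=` S.
Proof.
pose T := {s : set L * set Q | `[< stage s.1 s.2 >]}.
have t0 : T by exists (S0, P0); apply/asboolP/stage0.
pose le (s t : T) := `[< stage_le (val s).1 (val s).2 (val t).1 (val t).2 >].
have [||A Atot|m mP] := ZL_preorder t0 (R := le).
- by move=> t; apply/asboolP; exact: stage_le_refl.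
- move=> r s t /asboolP rs /asboolP st; apply/asboolP; exact: stage_le_trans rs st.
- have [|_ _ [s As <-] [t At <-]|u [us uP]] := @stage_chain (val @` A).
  + by move=> _ [s As <-]; exact/asboolP/(valP s).
  + by have [/asboolP|/asboolP] := Atot _ _ As At; [left|right].
  exists (exist _ u (asboolT us)) => s As; apply/asboolP => /=.
  by apply: uP; exists s.
exists (val m).1, (val m).2; split; first exact/asboolP/(valP m).
move=> S' P' st mle.
have /asboolP[] // := mP (exist _ (S', P') (asboolT st)) (asboolT mle).
Qed.

(** * Enlarging a stage by the witnesses of one task *)

Section Extension.
Variables (S : set L) (P : set Q).
Hypothesis stSP : stage S P.
Variables (Z : topologicalType) (pi : Z -> Q).
Hypotheses (contZ : continuum Z) (cpi : continuous pi).
Hypotheses (piP : forall z, P (pi z)).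
Hypothesis (pi_onto : forall x, P x -> exists z, agree S x (pi z)).
Variables (a : nat -> CX R Z) (t : task).
Hypothesis tS : forall j, depends_on S (t.1 j).
Hypothesis tE : forall k, t.2 k <-> exists z,
  in_box k (fun i => evC (a i) z) (fun j => evC (t.1 j) (pi z)).
Hypothesis fresh : forall c, ~ S (enc (t, c)).

(** The functions [a i] are written into the coordinates reserved for [t], next to the map [pi]. The
    image of [Z] is a continuum in the coordinates [S'], and the new stage is its cylinder. *)
Lemma stage_extension : exists S' P', [/\ stage S' P', stage_le S P S' P' &
  forall c, S' (enc (t, c))].
Proof.
have [Z0 cZ hZ coZ] := contZ; have [clP cP satP rlP leP] := stSP.
have /choice[M MP] : forall i, exists M : R, 0 < M /\ forall z, Cnm (evC (a i) z) <= M.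
  move=> i; have [M M0 aM] := compact_Cnm_bounded cZ (@continuous_evC _ _ (a i)).
  exists (M + 1); split; first by rewrite ltr_wpDl.
  by move=> z; apply: le_trans (aM z) _; rewrite lerDl.
pose S' := S `|` [set l | exists c, l = enc (t, c)].
(* Real and imaginary parts are scaled by a positive bound to fit into $[-1,1]$; [cf] multiplies by
   it again. *)
pose w (c : nat * bool) (z : Z) : R :=
  (if c.2 then Cim (evC (a c.1) z) else Cre (evC (a c.1) z)) / M c.1.
have wP c z : -1 <= w c z <= 1.
  have [M0 aM] := MP c.1; rewrite -ler_norml /w normrM normfV (gtr0_norm M0).
  rewrite ler_pdivrMr // mul1r; apply: le_trans (aM z).
  by case: c.2; [exact: Cim_le|exact: Cre_le].
(* By [fresh] the reserved coordinates do not overwrite those of the stage. Elsewhere [restr] leaves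
   0 outside [S], so that [psi z] is its own restriction to [S']. *)
pose psi (z : Z) : Q := fun l =>
  if pselect (exists c, l = enc (t, c)) is left h then seg_of (w (projT1 (cid h)) z)
  else restr S (pi z) l.
have psi_enc z c : crd (enc (t, c)) (psi z) = w c z.
  rewrite /crd /psi; case: pselect => [h|[]]; last by exists c.
  by case: (cid h) => d /= /encI[<-]; rewrite seg_ofK.
have psi_S z : agree S (pi z) (psi z).
  move=> l Sl; rewrite /psi; case: pselect => [[c lc]|_].
    by exfalso; apply: (fresh (c := c)); rewrite -lc.
  exact: agree_restr.
have psi_supp z : restr S' (psi z) = psi z.
  apply: crd_inj => l; rewrite crd_restr; case: asboolP => // nS'.
  rewrite /crd /psi; case: pselect => [h|_]; first by exfalso; apply: nS'; right.
  rewrite -[RHS]/(crd l (restr S (pi z))) crd_restr; case: asboolP => // Sl.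
  by exfalso; apply: nS'; left.
have cpsi : continuous psi.
  apply: continuous_to_cube => l.
  have [[c ->]|nl] := pselect (exists c, l = enc (t, c)).
    under eq_fun do rewrite psi_enc.
    move=> z; apply: cvgM; last exact: cvg_cst.
    by case: c.2; [exact: continuous_Cim (@continuous_evC _ _ _) z|
      exact: continuous_Cre (@continuous_evC _ _ _) z].
  rewrite (_ : (fun z => _) = crd l \o (restr S \o pi)).
    move=> z; apply: continuous_comp; last exact: continuous_crd.
    by apply: continuous_comp; [exact: cpi|exact: continuous_restr].
  by apply/funext => z; rewrite /= /crd /psi; case: pselect.
have cW : connected (range psi) by exact: connected_image.
have clW : closed (range psi).
  by apply: compact_closed (@hausdorff_cube R L) _; exact: compact_image.
pose P' := [set x | range psi (restr S' x)].
have P'E x : P' x <-> exists z, agree S' x (psi z).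
  split=> [[z _ zx]|[z xz]]; exists z => //.
    by rewrite zx; exact: agree_restr.
  by rewrite (restr_agree xz) psi_supp.
have SS' : S `<=` S' by move=> l; left.
have leSP : stage_le S P S' P'.
  split=> // [x /P'E[z xz]|x /pi_onto[z xz]].
    apply: satP (piP z); apply: agree_sym.
    exact: agree_trans (agree_sub SS' xz) (agree_sym (psi_S z)).
  exists (psi z); first by apply/P'E; exists z.
  exact: agree_trans xz (psi_S z).
exists S', P'; split=> //; last by move=> c; right; exists c.
split.
- have -> : P' = restr S' @^-1` range psi by [].
  by apply: preimage_closed => // x _; exact: continuous_restr.
- apply: connected_cylinder cW => _ [z _ <-]; exists (psi z) => //.
- move=> x y xy /P'E[z xz]; apply/P'E; exists z.
  exact: agree_trans (agree_sym xy) xz.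
- move=> t' c [/rlP rl|[c' /encI[-> _]]]; first exact: realizes_le leSP rl.
  split; first by move=> j; exact: depends_on_sub (tS j).
  have cf i : continuous (fun x : Q => Cmk (M i) 0 *
      Cmk (crd (enc (t, (i, false))) x) (crd (enc (t, (i, true))) x)).
    have c1 := @continuous_Cmk R Q _ _ (@continuous_crd R L (enc (t, (i, false))))
      (@continuous_crd R L (enc (t, (i, true)))).
    exact: (@cts_scale R Q (Cmk (M i) 0) (mkC c1)).
  exists (fun i => mkC (cf i)); split.
    move=> i x y xy.
    have e b : crd (enc (t, (i, b))) x = crd (enc (t, (i, b))) y.
      by rewrite /crd xy //; right; exists (i, b).
    rewrite -[LHS]/(Cmk (M i) 0 *
      Cmk (crd (enc (t, (i, false))) x) (crd (enc (t, (i, true))) x)).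
    by rewrite !e.
  have aE x z i : agree S' x (psi z) -> evC (mkC (cf i)) x = evC (a i) z.
    move=> xz; rewrite -[LHS]/(Cmk (M i) 0 *
      Cmk (crd (enc (t, (i, false))) x) (crd (enc (t, (i, true))) x)).
    have crdE c'' : crd (enc (t, c'')) x = w c'' z.
      by rewrite -psi_enc /crd xz //; right; exists c''.
    rewrite !crdE /w /=; have [/lt0r_neq0 M0 _] := MP i.
    rewrite -[RHS]CmkK -[LHS]/(Cmk (_ - _) (_ + _)) !mul0r subr0 addr0.
    by rewrite !(mulrC (M i)) !divfK.
  have tE' x z j : agree S' x (psi z) -> evC (t.1 j) x = evC (t.1 j) (pi z).
    move=> xz; apply: tS.
    exact: agree_trans (agree_sub SS' xz) (agree_sym (psi_S z)).
  move=> k; rewrite tE; split=> [[z [zu zv]]|[x /P'E[z xz] [xu xv]]].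
    exists (psi z); first by apply/P'E; exists z.
    by split=> i ik; [rewrite (aE _ z) //; exact: zu|rewrite (tE' _ z) //; exact: zv].
  exists z; split=> i ik; first by rewrite -(aE x) //; exact: xu.
  by rewrite -(tE' x) //; exact: xv.
- exact: stage_le_trans leP leSP.
Qed.

End Extension.
End Stages.

(** * The space of a maximal stage *)

Section TietzeComplex.
Variables (R : realType) (T : topologicalType) (A : set T).
Hypotheses (cT : compact [set: T]) (hT : hausdorff_space T) (clA : closed A).

Lemma tietze_real (b : A -> R) : continuous b -> (exists M, forall x, `|b x| <= M) ->
  exists2 g : T -> R, continuous g & forall x, g (set_val x) = b x.
Proof.
move=> cb [M bM].
pose f (x : T) : R := if pselect (A x) is left h then b (SigSub (mem_set h)) else 0.
have fE (x : A) : f (set_val x) = b x.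
  rewrite /f; case: pselect => [h|[]]; last exact: set_valP.
  by congr b; apply: val_inj.
have [||x Ax|g [gE cg _]] := @continuous_bounded_extension T R
    (compact_normal hT cT) A clA f (Num.max M 1).
- by rewrite lt_max ltr01 orbT.
- apply/subspace_sigL_continuousP; rewrite (_ : sigL A f = b) //.
  by apply/funext => x; exact: fE.
- have [y <-] := set_val_surj Ax; rewrite fE le_max; apply/orP; left; exact: bM.
exists g => // x; rewrite -fE gE //; apply/mem_set; exact: set_valP.
Qed.

Lemma tietze_complex (b : CX R A) : exists B : CX R T,
  forall x, evC B (set_val x) = evC b x.
Proof.
have [M _ bM] := compact_Cnm_bounded
  (compact_set_type (subclosed_compact clA cT (@subsetT _ A))) (@continuous_evC _ _ b).
have [|g cg gE] := tietze_real (continuous_Cre (@continuous_evC _ _ b)).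
  by exists M => x; apply: le_trans (Cre_le _) (bM x).
have [|h ch hE] := tietze_real (continuous_Cim (@continuous_evC _ _ b)).
  by exists M => x; apply: le_trans (Cim_le _) (bM x).
exists (mkC (continuous_Cmk cg ch)) => x.
by rewrite -[LHS]/(Cmk (g (set_val x)) (h (set_val x))) gE hE CmkK.
Qed.

End TietzeComplex.

Section MaximalStage.
Variables (R : realType) (L : choiceType).
Local Notation C := (Cplx R).
Local Notation Q := (cube R L).
Variable enc : task R L * (nat * bool) -> L.
Hypothesis encI : injective enc.
Variables (S0 : set L) (P0 : set Q).
Hypotheses (S0_enc : forall t, ~ S0 (enc t)) (P00 : P0 !=set0).
Variables (S : set L) (P : set Q).
Hypothesis stSP : stage enc S0 P0 S P.
Hypothesis maxSP : forall S' P', stage enc S0 P0 S' P' -> stage_le S P S' P' -> S' `<=` S.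

(** The coordinates off [S] are free in the cylinder; fixing them at 0 selects one point of each
    fibre, hence a copy of the continuum itself. *)
Definition stage_set : set Q := [set x | P x /\ restr S x = x].

Definition stage_space : topologicalType := set_type stage_set.

Lemma stage_set_restr x : P x -> stage_set (restr S x).
Proof.
move=> Px; have [_ _ sat _ _] := stSP; split; last exact: restr_id.
exact: sat (@agree_restr _ _ _ _) Px.
Qed.

Lemma stage_set_image : stage_set = restr S @` P.
Proof.
apply/seteqP; split=> [x [Px <-]|_ [x Px <-]]; first by exists x.
exact: stage_set_restr.
Qed.

Lemma closed_stage_set : closed stage_set.
Proof.
apply: compact_closed (@hausdorff_cube R L) _; rewrite stage_set_image.
apply: compact_image; first exact: continuous_restr.
have [clP _ _ _ _] := stSP.
exact: subclosed_compact clP (@compact_cube R L) (@subsetT _ P).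
Qed.

Lemma continuum_stage_space : continuum stage_space.
Proof.
split.
- have [x Px] := stage_nonempty P00 stSP.
  by have [y _] := set_val_surj (stage_set_restr Px); exists y.
- apply/compact_set_type/subclosed_compact; [exact: closed_stage_set|exact: compact_cube|].
  exact: subsetT.
- exact/hausdorff_set_type/hausdorff_cube.
- apply: connected_set_type; rewrite stage_set_image.
  apply: connected_image; first exact: continuous_restr.
  by have [] := stSP.
Qed.

Lemma stage_space_points x : P x -> exists y : stage_space, agree S x (set_val y).
Proof.
move=> Px; have [y yE] := set_val_surj (stage_set_restr Px).
by exists y; rewrite yE; exact: agree_restr.
Qed.

(** Parameters of tasks are functions on the whole cube: Tietze extends [b], and composing with
    [restr S] removes the dependence on other coordinates. *)
Lemma stage_space_extend (b : CX R stage_space) : exists2 B : CX R Q,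
  depends_on S B & forall x, evC B (set_val x) = evC b x.
Proof.
have [B BE] := tietze_complex (@compact_cube R L) (@hausdorff_cube R L)
  closed_stage_set b.
have cB : continuous (evC B \o restr S).
  move=> x; apply: continuous_comp; first exact: continuous_restr.
  exact: continuous_evC.
exists (mkC cB) => [x y xy|x].
  by rewrite -[LHS]/(evC B (restr S x)) (restr_agree xy).
rewrite -[LHS]/(evC B (restr S (set_val x))).
by have [_ ->] : stage_set (set_val x) by exact: set_valP.
Qed.

Lemma stage_space_existentially_closed :
  existentially_closed (CX R stage_space).
Proof.
apply: realizing_existentially_closed; first exact: continuum_stage_space.
move=> Z pi contZ cpi pi_onto m k a b.
have [clP _ satP rlP _] := stSP.
have /choice[B BP] : forall j : 'I_k, exists B : CX R Q,
    depends_on S B /\ forall x, evC B (set_val x) = evC (b j) x.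
  by move=> j; have [B BS BE] := stage_space_extend (b j); exists B.
(* Tuples are padded by 0 to sequences; boxes with lists of lengths [m] and [k] see only the
   original entries. *)
pose b' j : CX R Q := if insub j is Some i then B i else czero _.
pose a' i : CX R Z := if insub i is Some j then a j else czero _.
have b'S j : depends_on S (b' j).
  by rewrite /b'; case: insubP => // i _ _; exact: (BP i).1.
have b'E (j : 'I_k) (x : stage_space) : evC (b' j) (set_val x) = evC (b j) x.
  rewrite /b'; case: insubP => [i _ ij|/negP[]//].
  by rewrite (BP i).2; congr (evC (b _) x); apply: val_inj.
have a'E (i : 'I_m) : a' i = a i.
  rewrite /a'; case: insubP => [j _ ji|/negP[]//].
  by congr a; apply: val_inj.
pose p z : Q := set_val (pi z).
have cp : continuous p.
  by move=> z; apply: continuous_comp; [exact: cpi|exact: set_val_continuous].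
have pP z : P (p z) by have [] : stage_set (p z) by exact: set_valP.
have p_onto x : P x -> exists z, agree S x (p z).
  by move=> /stage_space_points[y xy]; have [z zy] := pi_onto y; exists z; rewrite /p zy.
(* The task records the boxes met by the joint range on the given [Z]. *)
pose t : task R L := (b', [set q | exists z,
  in_box q (fun i => evC (a' i) z) (fun j => evC (b' j) (p z))]).
have [_ [c [cS cP]]] : realizes S P t.
  (* A single reserved coordinate in [S] already means that the task is realized. If there is none,
     [Z] itself allows an extension, against maximality. *)
  have [[d Sd]|nS] := pselect (exists c, S (enc (t, c))); first exact: rlP Sd.
  have fr d : ~ S (enc (t, d)) by move=> Sd; apply: nS; exists d.
  have [S' [P' [st' le' S'c]]] := @stage_extension _ _ _ encI _ _ _ _ stSP _ _
    contZ cp pP p_onto a' t b'S (fun q => iff_refl _) fr.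
  have [_ _ _ rl' _] := st'; have := maxSP st' le' (S'c (0%N, true)).
  by move=> h; exfalso; apply: nS; exists (0%N, true).
have cc i : continuous (fun x : stage_space => evC (c i) (set_val x)).
  move=> x; apply: continuous_comp; first exact: set_val_continuous.
  exact: continuous_evC.
have [Z0 cZ _ _] := contZ.
exists (fun i => mkC (cc i)); split=> [x|z].
  have Px : P (set_val x) by have [] : stage_set (set_val x) by exact: set_valP.
  (* Every box around the values at [x] belongs to the task, so it is met on [Z], and compactness of
     [Z] makes the match exact. The converse below uses compactness of [P]. *)
  have [||q _ _ qx|z _ [za zb]] := @boxes_realized R Z setT
    (fun i => evC (a' i)) (fun j z => evC (b' j) (p z))
    (fun i => evC (c i) (set_val x)) (fun j => evC (b' j) (set_val x)) m k cZ.
  - by move=> i; exact: continuous_evC.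
  - by move=> j z; apply: continuous_comp; [exact: cp|exact: continuous_evC].
  - have [|z zq] := iffRL (cP q); last by exists z.
    by exists (set_val x).
  exists z; split=> [i|j]; first by rewrite -a'E za // ltn_ord.
  by rewrite -!b'E -zb // ltn_ord.
have cptP : compact P by exact: subclosed_compact clP (@compact_cube R L) (@subsetT _ P).
have [||q _ _ qz|x Px [xa xb]] := @boxes_realized R Q P
    (fun i => evC (c i)) (fun j => evC (b' j))
    (fun i => evC (a' i) z) (fun j => evC (b' j) (p z)) m k cptP.
- by move=> i; exact: continuous_evC.
- by move=> j; exact: continuous_evC.
- by have [|x Px xq] := iffLR (cP q); [exists z|exists x].
have [y xy] := stage_space_points Px.
exists y; split=> [i|j].
  rewrite -[LHS]/(evC (c i) (set_val y)) -(cS i _ _ xy) -a'E; exact: xa.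
by rewrite -!b'E -(b'S j _ _ xy); exact: xb.
Qed.

End MaximalStage.

(** * The circle *)

Section Turn.
Variable R : realType.
Local Notation C := (Cplx R).
Implicit Types (t : R) (z w : C).

(** This is $e^{2\pi i t}$; the normalization makes the integers the kernel. *)
Definition turn t : C := Cmk (cos (pi *+ 2 * t)) (sin (pi *+ 2 * t)).

Lemma pi2_gt0 : 0 < pi *+ 2 :> R.
Proof. by rewrite pmulrn_rgt0 // pi_gt0. Qed.

Lemma pi2_neq0 : pi *+ 2 != 0 :> R.
Proof. exact: lt0r_neq0 pi2_gt0. Qed.

Lemma turnD s t : turn (s + t) = turn s * turn t.
Proof. by rewrite /turn mulrDr cosD sinD /Cmk; congr Complex; ring. Qed.

Lemma turn0 : turn 0 = 1.
Proof. by rewrite /turn mulr0 cos0 sin0. Qed.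

Lemma turn1 : turn 1 = 1.
Proof. by rewrite /turn mulr1 cos2pi sin2pi. Qed.

Lemma turnNr t : turn t * turn (- t) = 1.
Proof. by rewrite -turnD subrr turn0. Qed.

Lemma turn_neq0 t : turn t != 0.
Proof.
apply/eqP => t0; have := turnNr t; rewrite t0 mul0r => /eqP.
by rewrite eq_sym oner_eq0.
Qed.

Lemma turnN t : turn (- t) = (turn t)^-1.
Proof. by apply: (mulfI (turn_neq0 t)); rewrite turnNr divff // turn_neq0. Qed.

Lemma turnMn t n : turn (t *+ n) = turn t ^+ n.
Proof. by elim: n => [|n IH]; rewrite ?mulr0n ?turn0 // mulrS turnD IH exprS. Qed.

Lemma turnMz t (n : int) : turn (t *~ n) = turn t ^ n.
Proof. by case: n => n; rewrite ?NegzE ?mulrNz ?turnN -?exprnN turnMn. Qed.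

Lemma turn_int (n : int) : turn n%:~R = 1.
Proof. by rewrite turnMz turn1 exp1rz. Qed.

Lemma Cnm_turn t : Cnm (turn t) = 1.
Proof. by rewrite CnmE /= cos2Dsin2 sqrtr1. Qed.

Lemma continuous_turn : continuous turn.
Proof.
have c2 : continuous (fun t : R => pi *+ 2 * t).
  by move=> t; apply: cvgM; [exact: cvg_cst|exact: cvg_id].
apply: continuous_Cmk => t.
  exact: (continuous_comp (c2 t) (@continuous_cos R _)).
exact: (continuous_comp (c2 t) (@continuous_sin R _)).
Qed.

Lemma turn_eq1 t : turn t = 1 -> exists n : int, t = n%:~R.
Proof.
move=> t1; pose s := t - (Num.floor t)%:~R.
have cs : cos (pi *+ 2 * s) = 1.
  have : turn s = 1 by rewrite /s turnD -mulrNz turn_int mulr1.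
  by move=> /(congr1 (@Cre R)).
have s0 : 0 <= s by rewrite subr_ge0 floor_le.
have s1 : s < 1 by have := floorD1_gt t; rewrite intrD /s; lra.
(* Cosine is injective only on $[0,\pi]$, that is for [r] up to 1/2; the other half of the period is
   treated through [1 - s]. *)
have pos (r : R) : 0 <= r -> r <= 2^-1 -> cos (pi *+ 2 * r) = 1 -> r = 0.
  move=> r0 r1 cr; have := @cos_inj R (pi *+ 2 * r) 0.
  rewrite cr cos0 !in_itv /= lexx pi_ge0 /=.
  have -> : 0 <= pi *+ 2 * r <= pi.
    rewrite mulr_ge0 ?(ltW pi2_gt0) //=.
    have := ler_wpM2l (ltW pi2_gt0) r1; rewrite mulr2n mulrDl => /le_trans; apply.
    by have := pi_ge0 R; lra.
  move=> /(_ isT isT erefl)/eqP; rewrite mulf_eq0 (negbTE pi2_neq0) /=.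
  by move/eqP.
have [s2|s2] := leP s 2^-1.
  by exists (Num.floor t); apply/eqP; rewrite -subr_eq0; apply/eqP; exact: pos.
have /eqP : 1 - s = 0.
  apply: pos; [lra|lra|].
  by rewrite mulrBr mulr1 cosB cos2pi sin2pi cs mulr1 mul0r addr0.
by rewrite subr_eq0 => /eqP s1'; move: s1; rewrite -s1' ltxx.
Qed.

Lemma turn_onto w : Cnm w = 1 -> exists t, turn t = w.
Proof.
case: w => x y w1; have xy : x ^+ 2 + y ^+ 2 = 1.
  by rewrite -(@Cnm_sqr R (Complex x y)) w1 expr1n.
have x1 : -1 <= x <= 1.
  by rewrite -ler_norml -w1; exact: (@Cre_le R (Complex x y)).
have sa : sin (acos x) = `|y|.
  by rewrite sin_acos // -xy (addrC (x ^+ 2)) addrK sqrtr_sqr.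
have ca : cos (acos x) = x by apply: acosK; rewrite in_itv.
have div (r : R) : pi *+ 2 * (r / (pi *+ 2)) = r.
  by rewrite mulrC divfK // pi2_neq0.
have [y0|y0] := leP 0 y.
  by exists (acos x / (pi *+ 2)); rewrite /turn div sa ca ger0_norm.
exists (- (acos x) / (pi *+ 2)); rewrite /turn div sinN cosN sa ca.
by rewrite ltr0_norm // opprK.
Qed.

(** A branch of $\log(w)/(2\pi i)$ on the right half of the unit circle, where the imaginary part
    determines the angle. *)
Definition turn_log w : R := asin (Cim w) / (pi *+ 2).

Lemma unit_Cim w : Cnm w = 1 -> 0 < Cre w -> -1 < Cim w < 1.
Proof.
move=> w1 w0; rewrite -ltr_norml -[ltRHS]ger0_norm // -ltr_sqr ?nnegrE //.
rewrite !real_normK ?num_real // expr1n -[ltRHS](expr1n _ 2) -w1 Cnm_sqr.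
by rewrite ltrDr exprn_gt0.
Qed.

Lemma turn_logK w : Cnm w = 1 -> 0 < Cre w -> turn (turn_log w) = w.
Proof.
move=> w1 w0; have /andP[/ltW i1 /ltW i2] := unit_Cim w1 w0.
have i12 : -1 <= Cim w <= 1 by rewrite i1.
rewrite /turn /turn_log mulrC divfK ?pi2_neq0 // asinK ?in_itv //.
rewrite cos_asin // -[w in RHS]CmkK; congr Cmk.
have -> : 1 - Cim w ^+ 2 = Cre w ^+ 2 by rewrite -(expr1n _ 2) -w1 Cnm_sqr addrK.
by rewrite sqrtr_sqr gtr0_norm.
Qed.

Lemma continuous_turn_log (X : topologicalType) (f : X -> C) x : continuous f ->
  Cnm (f x) = 1 -> 0 < Cre (f x) -> {for x, continuous (fun y => turn_log (f y))}.
Proof.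
move=> cf f1 f0; apply: cvgM; last exact: cvg_cst.
apply: (@continuous_comp X R R (fun y => Cim (f y)) asin); first exact: continuous_Cim.
exact/continuous_asin/unit_Cim.
Qed.

Lemma turn_log_lt w : Cnm w = 1 -> 0 < Cre w -> `|turn_log w| < 4^-1.
Proof.
move=> w1 w0; have /andP[i1 i2] := unit_Cim w1 w0.
rewrite /turn_log normrM normfV (gtr0_norm pi2_gt0) ltr_pdivrMr ?pi2_gt0 //.
have -> : 4^-1 * (pi *+ 2) = pi / 2 :> R by rewrite -mulr_natr; field.
by rewrite ltr_norml asin_gtNpi2 ?asin_ltpi2 // ?i1 ?i2 ?ltW.
Qed.

End Turn.

(** * The wedge of solenoids *)

(* Functions to the circle presenting a map from [X] onto a wedge of copies,
   indexed by [I], of the dyadic solenoid. *)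
Record solenoid_map (R : realType) (I : Type) (X : topologicalType)
    (z : I -> nat -> X -> Cplx R) : Prop := SolenoidMap {
  solenoid_continuous : forall s n, continuous (z s n);
  solenoid_unit : forall s n x, Cnm (z s n x) = 1;
  solenoid_sqr : forall s n x, z s n.+1 x ^+ 2 = z s n x;
  solenoid_wedge : forall s s' x, s <> s' -> z s 0%N x = 1 \/ z s' 0%N x = 1;
  solenoid_onto : forall s t, exists x, (forall n, z s n x = turn (t / 2 ^+ n)) /\
    forall s' n, s' <> s -> z s' n x = 1
}.

Section SolenoidWedge.
Variables (R : realType) (L : choiceType) (I : Type) (i0 : I).
Local Notation C := (Cplx R).
Local Notation Q := (cube R L).
Variable base : I * nat * bool -> L.
Hypothesis baseI : injective base.

Definition wedge_coord (s : I) (n : nat) (x : Q) : C :=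
  Cmk (crd (base (s, n, false)) x) (crd (base (s, n, true)) x).

Lemma continuous_wedge_coord s n : continuous (wedge_coord s n).
Proof. by apply: continuous_Cmk; exact: continuous_crd. Qed.

(** The one-parameter subgroup $t \mapsto (e^{2\pi i t/2^n})_n$, dense in the solenoid of index [s],
    with all other solenoids at their base point 1. *)
Definition wedge_line (s : I) (t : R) : Q := fun l =>
  if pselect (exists c, l = base c) is left h then
    let c := projT1 (cid h) in
    let z := if `[< c.1.1 = s >] then turn (t / 2 ^+ c.1.2) else 1 in
    seg_of (if c.2 then Cim z else Cre z)
  else seg_of 0.

Lemma wedge_lineE s t s' n : wedge_coord s' n (wedge_line s t) =
  if `[< s' = s >] then turn (t / 2 ^+ n) else 1.
Proof.
have crdE b : crd (base (s', n, b)) (wedge_line s t) =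
    let z : C := if `[< s' = s >] then turn (t / 2 ^+ n) else 1 in
    if b then Cim z else Cre z.
  rewrite /crd /wedge_line; case: pselect => [h|[]]; last by exists (s', n, b).
  case: (cid h) => c lc /=; rewrite -(baseI lc) /=; apply: seg_ofK.
  rewrite -ler_norml.
  have key (b' : bool) (w : C) : Cnm w = 1 -> `|if b' then Cim w else Cre w| <= 1.
    by move=> <-; case: b'; [exact: Cim_le|exact: Cre_le].
  by apply: key; case: asboolP => _; rewrite ?Cnm_turn ?Cnm1.
by rewrite /wedge_coord !crdE /= CmkK.
Qed.

Lemma wedge_line_off s t l : ~ (exists c, l = base c) -> crd l (wedge_line s t) = 0.
Proof. by move=> nl; rewrite /crd /wedge_line; case: pselect => // _; exact: seg_val0. Qed.

Lemma continuous_wedge_line s : continuous (wedge_line s).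
Proof.
apply: continuous_to_cube => l.
have [[[[s' n] b] ->]|nl] := pselect (exists c, l = base c); last first.
  under eq_fun do rewrite wedge_line_off //.
  exact: cst_continuous.
have -> : (fun t => crd (base (s', n, b)) (wedge_line s t)) =
    (fun t => let z : C := if `[< s' = s >] then turn (t / 2 ^+ n) else 1 in
      if b then Cim z else Cre z).
  by apply/funext => t; rewrite -wedge_lineE; case: b.
case: asboolP => [e|e] /=; last by exact: cst_continuous.
have c1 : continuous (fun t : R => turn (t / 2 ^+ n)).
  move=> t; apply: continuous_comp; last exact: continuous_turn.
  by apply: cvgM; [exact: cvg_id|exact: cvg_cst].
by case: b; [exact: (continuous_Cim c1)|exact: (continuous_Cre c1)].
Qed.

Definition wedge_support : set L := range base.

(** All lines pass through the point of parameter 0, so the closure of their union is connected, and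
    closed conditions need only be checked on the lines. *)
Definition wedge : set Q := closure (\bigcup_s range (wedge_line s)).

Definition wedge_cylinder : set Q := [set x | wedge (restr wedge_support x)].

Lemma wedge_ind (F : set Q) : closed F -> (forall s t, F (wedge_line s t)) ->
  wedge `<=` F.
Proof.
move=> clF Fl; rewrite [F in _ `<=` F](iffLR (closure_id F)) //.
by apply: closureS => _ [s _ [t _ <-]].
Qed.

Lemma wedge_restr : wedge `<=` range (restr wedge_support).
Proof.
apply: wedge_ind.
  apply: compact_closed (@hausdorff_cube R L) _.
  by apply: compact_image; [exact: continuous_restr|exact: compact_cube].
move=> s t; exists (wedge_line s t) => //; apply: crd_inj => l.
rewrite crd_restr; case: asboolP => // nl; rewrite wedge_line_off //.
by move=> [c lc]; apply: nl; exists c.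
Qed.

Lemma connected_wedge : connected wedge.
Proof.
apply: connected_closure; apply: bigcup_connected.
  exists (wedge_line i0 0) => s _; exists 0 => //; apply: crd_inj => l.
  have [[[[s' n] b] ->]|nl] := pselect (exists c, l = base c); last first.
    by rewrite !wedge_line_off.
  have E s1 : wedge_coord s' n (wedge_line s1 0) = 1.
    by rewrite wedge_lineE; case: asboolP => [e|e] //; rewrite mul0r turn0.
  have crdE s1 : crd (base (s', n, b)) (wedge_line s1 0) =
      if b then Cim (1 : C) else Cre 1.
    by rewrite -(E s1); case: b.
  by rewrite !crdE.
move=> s _; apply: connected_image; first exact: continuous_wedge_line.
by apply/connected_intervalP.
Qed.

Lemma closed_wedge_cylinder : closed wedge_cylinder.
Proof.
have -> : wedge_cylinder = restr wedge_support @^-1` wedge by [].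
apply: preimage_closed; last exact: closed_closure.
by move=> x _; exact: continuous_restr.
Qed.

Lemma connected_wedge_cylinder : connected wedge_cylinder.
Proof. exact: connected_cylinder wedge_restr connected_wedge. Qed.

Lemma wedge_cylinder_agree x y : agree wedge_support x y ->
  wedge_cylinder x -> wedge_cylinder y.
Proof. by move=> xy; rewrite /wedge_cylinder /= (restr_agree xy). Qed.

Lemma wedge_line_cylinder s t : wedge_cylinder (wedge_line s t).
Proof.
have : wedge (wedge_line s t) by apply: subset_closure; exists s => //; exists t.
by move=> /[dup] /wedge_restr[y _ <-]; rewrite /wedge_cylinder /= restr_id.
Qed.

Lemma wedge_coord_agree s n x y : agree wedge_support x y ->
  wedge_coord s n x = wedge_coord s n y.
Proof. by move=> xy; rewrite /wedge_coord /crd !xy //; eexists. Qed.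

Lemma wedge_cylinder_ind (F : set Q) : closed F -> (forall s t, F (wedge_line s t)) ->
  (forall x y, agree wedge_support x y -> F x -> F y) -> wedge_cylinder `<=` F.
Proof.
move=> clF Fl Fa x /(wedge_ind clF Fl); apply: Fa.
exact/agree_sym/agree_restr.
Qed.

Lemma wedge_coord_unit s n x : wedge_cylinder x -> Cnm (wedge_coord s n x) = 1.
Proof.
apply: (@wedge_cylinder_ind [set x | Cnm (wedge_coord s n x) = 1]).
- have -> : [set x | Cnm (wedge_coord s n x) = 1] =
    (fun x => Cnm (wedge_coord s n x)) @^-1` [set 1] by [].
  apply: preimage_closed; last exact: closed_eq.
  by move=> y _; apply: continuous_Cnm; exact: continuous_wedge_coord.
- by move=> s' t; rewrite /= wedge_lineE; case: asboolP => [e|e]; rewrite ?Cnm_turn ?Cnm1.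
- by move=> y y' yy /=; rewrite (wedge_coord_agree _ _ yy).
Qed.

Lemma wedge_coord_sqr s n x : wedge_cylinder x ->
  wedge_coord s n.+1 x ^+ 2 = wedge_coord s n x.
Proof.
apply: (@wedge_cylinder_ind [set x | wedge_coord s n.+1 x ^+ 2 = wedge_coord s n x]).
- apply: closed_eq_Cplx; last exact: continuous_wedge_coord.
  have c1 := @continuous_wedge_coord s n.+1.
  exact: (@cts_mul R Q (mkC c1) (mkC c1)).
- move=> s' t /=; rewrite !wedge_lineE; case: asboolP => [e|e]; last by rewrite expr1n.
  rewrite -turnMn; congr turn; rewrite exprS invfM -mulr_natr.
  by field; rewrite expf_neq0 // pnatr_eq0.
- by move=> y y' yy /=; rewrite !(wedge_coord_agree _ _ yy).
Qed.

Lemma wedge_coord_wedge s s' x : s <> s' -> wedge_cylinder x ->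
  wedge_coord s 0%N x = 1 \/ wedge_coord s' 0%N x = 1.
Proof.
(* As the vanishing of a product, the disjunction becomes a closed condition. *)
move=> ss' xW; suff : (wedge_coord s 0%N x - 1) * (wedge_coord s' 0%N x - 1) = 0.
  by move/eqP; rewrite mulf_eq0 !subr_eq0 => /orP[/eqP|/eqP]; [left|right].
move: x xW; apply: (@wedge_cylinder_ind [set x |
  (wedge_coord s 0%N x - 1) * (wedge_coord s' 0%N x - 1) = 0]).
- apply: closed_eq_Cplx; last exact: cst_continuous.
  have c1 s1 : continuous (fun y => wedge_coord s1 0%N y - 1).
    exact: (@cts_add R Q (mkC (@continuous_wedge_coord s1 0%N))
      (mkC (@cst_continuous Q C (-1)))).
  exact: (@cts_mul R Q (mkC (c1 s)) (mkC (c1 s'))).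
- move=> s1 t /=; rewrite !wedge_lineE; case: asboolP => [e|e]; last by rewrite subrr mul0r.
  case: asboolP => [e'|e']; last by rewrite subrr mulr0.
  by exfalso; apply: ss'; rewrite e e'.
- by move=> y y' yy /=; rewrite !(wedge_coord_agree _ _ yy).
Qed.

Lemma solenoid_map_wedge (X : topologicalType) (f : X -> Q) : continuous f ->
  (forall x, wedge_cylinder (f x)) ->
  (forall y, wedge_cylinder y -> exists x, agree wedge_support y (f x)) ->
  solenoid_map (fun s n x => wedge_coord s n (f x)).
Proof.
move=> cf fW f_onto; split.
- by move=> s n x; apply: continuous_comp; [exact: cf|exact: continuous_wedge_coord].
- by move=> s n x; exact: wedge_coord_unit.
- by move=> s n x; exact: wedge_coord_sqr.
- by move=> s s' x ss'; exact: wedge_coord_wedge.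
- move=> s t; have [x fx] := f_onto _ (@wedge_line_cylinder s t).
  exists x; split=> [n|s' n ss']; rewrite -(wedge_coord_agree _ _ fx) wedge_lineE.
    by case: asboolP.
  by case: asboolP.
Qed.

End SolenoidWedge.

(** * Classes of maps to the circle *)

Section CechClass.
Variables (R : realType) (X : topologicalType).
Local Notation C := (Cplx R).
Implicit Types (u v : X -> C) (h : cechH1 X).

(* The class in H^1 of a map to the circle: [th A] is a logarithm of [u] on
   the member [A] of the cover, and [c] is the cocycle of differences. *)
Definition represents h u : Prop :=
  exists W (hW : open_cover W) c (hc : cocycle1 W c) (th : set X -> X -> R),
  [/\ h = cech_class hW hc,
      forall A x, W A -> A x -> {for x, continuous (th A)} /\ turn (th A x) = u x &
      forall A B x, W A -> W B -> A x -> B x -> th B x - th A x = (c A B)%:~R].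

Lemma represents0 : represents 0 (fun=> 1).
Proof.
exists _, (@trivial_coverP X), _, (@cocycle10 _ _), (fun _ _ => 0); split=> //.
  by move=> A x _ _; split; [exact: cvg_cst|rewrite turn0].
by move=> A B x _ _ _ _; rewrite subrr.
Qed.

Lemma representsD h u k v : represents h u -> represents k v ->
  represents (h + k) (fun x => u x * v x).
Proof.
move=> [W [hW [c [hc [th [-> thu thc]]]]]] [V [hV [d [hd [et [-> etv etd]]]]]].
have f1 := @meet_fstP _ W V; have f2 := @meet_sndP _ W V.
pose hM := meet_coverP hW hV.
exists _, hM, _, (cocycle1D (cocycle1_pull f1 hc) (cocycle1_pull f2 hd)),
  (fun A x => th (meet_fst W V A) x + et (meet_snd W V A) x); split.
- rewrite -[LHS]/(cech_add _ _) /cech_class.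
  rewrite (@cech_class_pull _ (CechCocycle hW hc) _ hM _ f1).
  rewrite (@cech_class_pull _ (CechCocycle hV hd) _ hM _ f2).
  exact: cech_addE.
- move=> A x MA Ax; have [W1 /(_ x Ax) A1] := f1 A MA; have [V2 /(_ x Ax) A2] := f2 A MA.
  have [c1 <-] := thu _ _ W1 A1; have [c2 <-] := etv _ _ V2 A2.
  by split; [exact: cvgD|rewrite turnD].
- move=> A B x MA MB Ax Bx.
  have [W1 /(_ x Ax) A1] := f1 A MA; have [V2 /(_ x Ax) A2] := f2 A MA.
  have [W1' /(_ x Bx) B1] := f1 B MB; have [V2' /(_ x Bx) B2] := f2 B MB.
  rewrite opprD addrACA (thc _ _ x) // (etd _ _ x) //.
  by rewrite -intrD.
Qed.

Lemma representsN h u : represents h u -> represents (- h) (fun x => (u x)^-1).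
Proof.
move=> [W [hW [c [hc [th [-> thu thc]]]]]].
exists _, hW, _, (cocycle1N hc), (fun A x => - th A x); split.
- exact: cech_oppE.
- move=> A x WA Ax; have [c1 <-] := thu A x WA Ax.
  by split; [exact: cvgN|rewrite turnN].
- move=> A B x WA WB Ax Bx.
  by rewrite intrN -(thc A B x) // opprB opprK addrC.
Qed.

Lemma represents_ext h u v : (forall x, u x = v x) -> represents h u -> represents h v.
Proof. by move=> uv; have -> : u = v by apply/funext. Qed.

Lemma representsMz h u (n : int) : represents h u ->
  represents (h *~ n) (fun x => u x ^ n).
Proof.
move=> hu; have nat (m : nat) : represents (h *+ m) (fun x => u x ^+ m).
  elim: m => [|m IH]; first exact: represents0.
  rewrite mulrS; apply: represents_ext (representsD hu IH) => x.
  by rewrite exprS.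
case: n => m; first exact: nat.
by rewrite NegzE mulrNz; apply: represents_ext (representsN (nat m.+1)) => x.
Qed.

Lemma represents_sum (T : Type) (s : seq T) (h : T -> cechH1 X) (u : T -> X -> C) :
  (forall a, represents (h a) (u a)) ->
  represents (\sum_(a <- s) h a) (fun x => \prod_(a <- s) u a x).
Proof.
move=> hu; elim: s => [|a s IH].
  rewrite big_nil; apply: represents_ext represents0 => x.
  by rewrite big_nil.
rewrite big_cons; apply: represents_ext (representsD (hu a) IH) => x.
by rewrite big_cons.
Qed.

(** The cover consists of preimages of open half circles. Their intersections may be disconnected,
    so local constancy of the integer jumps is not enough; the bound 1/4 on the local logarithms
    makes the jumps constant. *)
Lemma represents_exists u : continuous u -> (forall x, Cnm (u x) = 1) ->
  exists h, represents h u.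
Proof.
move=> cu u1.
pose rot (r : R) (x : X) : C := u x * turn (- r).
have rot1 r x : Cnm (rot r x) = 1 by rewrite CnmM u1 Cnm_turn mulr1.
have crot r : continuous (rot r).
  by move=> x; apply: cvgM; [exact: cu|exact: cvg_cst].
pose arc (r : R) : set X := [set x | 0 < Cre (rot r x)].
pose W : set (set X) := range arc.
have hW : open_cover W.
  split=> [_ [r _ <-]|].
    have -> : arc r = (fun x => Cre (rot r x)) @^-1` [set y | 0 < y] by [].
    have /continuousP := @continuous_Cre R X (rot r) (@crot r).
    by apply; exact: open_gt.
  rewrite -subTset => x _; have [t tx] := turn_onto (u1 x).
  exists (arc t); first by exists t.
  by rewrite /arc /= /rot -tx turnNr ltr01.
(* One arc arises from several centres [r], for instance [r] and [r + 1]; one is chosen for each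
   member. *)
have /choice[al alP] : forall A, exists r, W A -> A = arc r.
  move=> A; have [[r _ <-]|nA] := pselect (W A); first by exists r.
  by exists 0.
pose th A x : R := al A + turn_log (rot (al A) x).
have thu A x : W A -> A x -> {for x, continuous (th A)} /\ turn (th A x) = u x.
  move=> WA; rewrite {1}(alP A WA) => Ax; split.
    have cl := @continuous_turn_log R X _ x (@crot (al A)) (rot1 _ _) Ax.
    by apply: cvgD; [exact: cvg_cst|exact: cl].
  rewrite /th turnD turn_logK // mulrCA turnNr mulr1 //.
have th_near A x : W A -> A x -> `|th A x - al A| < 4^-1.
  move=> WA; rewrite {1}(alP A WA) => Ax.
  by rewrite /th (addrC (al A)) addrK; exact: turn_log_lt.
have /choice[c0 c0P] : forall p : set X * set X, exists k : int, forall x,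
    W p.1 -> W p.2 -> p.1 x -> p.2 x -> th p.2 x - th p.1 x = k%:~R.
  move=> [A B] /=.
  have [[x0 [WA WB Ax0 Bx0]]|no] := pselect (exists x, [/\ W A, W B, A x & B x]);
    last by exists 0 => x WA WB Ax Bx; exfalso; apply: no; exists x.
  have kx x : A x -> B x -> exists k : int, th B x - th A x = k%:~R.
    move=> Ax Bx; apply: turn_eq1; rewrite turnD turnN.
    by rewrite (thu A x WA Ax).2 (thu B x WB Bx).2 divff //; apply/eqP => ux;
      have := u1 x; rewrite ux Cnm0 => /eqP; rewrite eq_sym oner_eq0.
  have [k k0] := kx x0 Ax0 Bx0; exists k => x _ _ Ax Bx.
  have [l lx] := kx x Ax Bx; rewrite lx; congr (_%:~R).
  have := th_near A x WA Ax; have := th_near B x WB Bx.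
  have := th_near A x0 WA Ax0; have := th_near B x0 WB Bx0.
  rewrite !ltr_norml => /andP[? ?] /andP[? ?] /andP[? ?] /andP[? ?].
  (* The centres cancel in the difference of the two jumps, leaving four terms of size below 1/4,
     hence an integer of absolute value below 1. *)
  have lk : `|(l - k)%:~R| < 1 :> R.
    by rewrite intrB -lx -k0 ltr_norml; apply/andP; split; lra.
  have : `|l - k| < 0 + 1 :> int by rewrite add0r -(ltr_int R) intr_norm.
  by rewrite ltzD1 normr_le0 subr_eq0 => /eqP.
pose c A B := c0 (A, B).
have cP A B x : W A -> W B -> A x -> B x -> th B x - th A x = (c A B)%:~R.
  exact: (c0P (A, B) x).
have hc : cocycle1 W c.
  move=> A B D [WA WB WD [x [[Ax Bx] Dx]]]; apply/eqP; rewrite -(eqr_int R).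
  rewrite intrD intrB -(cP B D x) // -(cP A D x) // -(cP A B x) //.
  by apply/eqP; ring.
by exists (cech_class hW hc), W, hW, c, hc, th.
Qed.

(** On a refinement the cocycle is the coboundary of some [g]; subtracting the integers [g A] makes
    the local logarithms agree on overlaps, so they glue. *)
Lemma represents_zero u : represents 0 u ->
  exists2 F : X -> R, continuous F & forall x, turn (F x) = u x.
Proof.
move=> [W [hW [c [hc [th [h0 thu thc]]]]]].
have /pi_cechP[V [p [q [[oV cV] hp hq [g gP]]]]] :
  cech_class hW hc = cech_class hW (@cocycle10 X W) by rewrite -h0 -cech_zeroE.
have /choice[A AP] : forall x, exists A, V A /\ A x.
  move=> x; have : [set: X] x by [].
  by rewrite -cV => -[A VA Ax]; exists A.
pose F x := th (p (A x)) x - (g (A x))%:~R.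
have FE x B : V B -> B x -> F x = th (p B) x - (g B)%:~R.
  move=> VB Bx; have [VA Ax] := AP x.
  have [WA /(_ x Ax) pA] := hp _ VA; have [WB /(_ x Bx) pB] := hp _ VB.
  have := thc _ _ x WA WB pA pB.
  have := gP (A x) B; rewrite /pull subr0 /= => ->; last by split=> //; exists x.
  by rewrite intrB /F => e; apply/eqP; rewrite -subr_eq0; apply/eqP; lra.
exists F => x; have [VA Ax] := AP x; have [WA /(_ x Ax) pA] := hp _ VA.
  have [cth _] := thu _ _ WA pA.
  have cx : {for x, continuous (fun y => th (p (A x)) y - (g (A x))%:~R)}.
    by apply: cvgB; [exact: cth|exact: cvg_cst].
  have E : \forall y \near x, th (p (A x)) y - (g (A x))%:~R = F y.
    have : nbhs x (A x) by apply: open_nbhs_nbhs; split=> //; exact: oV.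
    by apply: filterS => y Ay; rewrite (FE y (A x)).
  by rewrite /continuous_at -(nbhs_singleton E); apply: cvg_trans cx; apply: near_eq_cvg.
have [_ <-] := thu _ _ WA pA.
by rewrite /F turnD turnN turn_int invr1 mulr1.
Qed.

End CechClass.

(** * Rank and weight *)

Section Rank.
Variables (R : realType) (I : Type) (X : topologicalType).
Local Notation C := (Cplx R).
Hypothesis contX : continuum X.
Variable z : I -> nat -> X -> C.
Hypothesis sz : solenoid_map z.

(** The only possible values are [k x] and its opposite, distinct as [c] is nonzero; each is taken
    on a closed set, so one of them fills [X]. *)
Lemma connected_sqrt_constant (k : X -> C) (c : C) : continuous k -> c != 0 ->
  (forall x, k x ^+ 2 = c) -> forall x y, k x = k y.
Proof.
move=> ck c0 kc x y; have [_ _ _ coX] := contX.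
have E w : k w = k x \/ k w = - k x.
  by have /eqP := etrans (kc w) (esym (kc x)); rewrite eqf_sqr;
    move=> /orP[/eqP|/eqP]; [left|right].
have cl (d : C) : closed [set w | k w = d].
  by apply: closed_eq_Cplx; [exact: ck|exact: cst_continuous].
have kx0 : k x != - k x.
  rewrite -subr_eq0 opprK -mulr2n mulrn_eq0 /=.
  by apply: contraNneq c0 => kx; rewrite -(kc x) kx expr0n.
suff E' : [set w | k w = k x] = [set: X].
  by have : [set: X] y by []; rewrite -E' /= => ->.
apply: coX; first by exists x.
- exists (~` [set w | k w = - k x]); first exact/closed_openC/cl.
  rewrite setTI; apply/seteqP; split=> w /= kw; last by have [|/kw] := E w.
  by rewrite kw => /eqP; rewrite (negbTE kx0).
- by exists [set w | k w = k x]; [exact: cl|rewrite setTI].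
Qed.

Lemma continuous_exprz (u : X -> C) (n : int) : continuous u ->
  (forall x, u x != 0) -> continuous (fun x => u x ^ n).
Proof.
move=> cu u0; have cn (m : nat) : continuous (fun x => u x ^+ m).
  elim: m => [|m IH]; first exact: cst_continuous.
  have -> : (fun x => u x ^+ m.+1) = (fun x => u x * u x ^+ m).
    by apply/funext => x; rewrite exprS.
  exact: (@cts_mul R X (mkC cu) (mkC IH)).
case: n => m; first exact: cn.
move=> x; rewrite NegzE.
apply: (@cvgV _ _ _ _ (fun y => u y ^+ m.+1)); last exact: cn.
by rewrite expf_neq0.
Qed.

Lemma solenoid_coord_neq0 s n x : z s n x != 0.
Proof.
apply/eqP => z0; have := solenoid_unit sz s n x; rewrite z0 Cnm0 => /eqP.
by rewrite eq_sym oner_eq0.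
Qed.

Lemma solenoid_no_log (T : eqType) (J : seq T) (idx : T -> I) (n : T -> int)
    (F : X -> R) a0 : uniq J -> a0 \in J -> n a0 != 0 ->
  (forall a, a \in J -> a <> a0 -> idx a <> idx a0) ->
  continuous F -> (forall x, turn (F x) = \prod_(a <- J) z (idx a) 0%N x ^ n a) -> False.
Proof.
move=> uJ Ja0 na0 idxI cF FE; have [X0 cX hX coX] := contX.
pose v N x : C := \prod_(a <- J) z (idx a) N x ^ n a.
have v_neq0 N x : v N x != 0.
  rewrite prodf_seq_neq0; apply/allP => a _.
  by rewrite expfz_neq0 // solenoid_coord_neq0.
have v_sqr N x : v N.+1 x ^+ 2 = v N x.
  rewrite -prodrXl; apply: eq_bigr => a _.
  by rewrite -(solenoid_sqr sz _ N) !exprnP !exprz_exp mulrC.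
have cv N : continuous (v N).
  rewrite /v; elim: (J) => [|a s IH].
    have -> : (fun x => \prod_(a <- [::]) z (idx a) N x ^ n a) = (fun=> 1).
      by apply/funext => x; rewrite big_nil.
    exact: cst_continuous.
  have ca := @continuous_exprz _ (n a) (@solenoid_continuous _ _ _ _ sz (idx a) N)
    (solenoid_coord_neq0 (idx a) N).
  have -> : (fun x => \prod_(a <- a :: s) z (idx a) N x ^ n a) =
      (fun x => z (idx a) N x ^ n a * \prod_(a <- s) z (idx a) N x ^ n a).
    by apply/funext => x; rewrite big_cons.
  exact: (@cts_mul R X (mkC ca) (mkC IH)).
(* The quotient of two $2^N$-th roots of the same function; since [k 0] is 1 and each [k N] is the
   square of the next, all are constant. *)
pose k N x : C := v N x * turn (- (F x / 2 ^+ N)).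
have ck N : continuous (k N).
  have ct : continuous (fun x => turn (- (F x / 2 ^+ N))).
    move=> x; apply: (@continuous_comp X R C (fun x => - (F x / 2 ^+ N)) (@turn R)).
      by apply: cvgN; apply: cvgM; [exact: cF|exact: cvg_cst].
    exact: continuous_turn.
  exact: (@cts_mul R X (mkC (@cv N)) (mkC ct)).
have k_neq0 N x : k N x != 0 by rewrite mulf_neq0 // turn_neq0.
have k0 x : k 0%N x = 1 by rewrite /k /v -FE expr0 divr1 turnNr.
have k_sqr N x : k N.+1 x ^+ 2 = k N x.
  rewrite /k exprMn v_sqr -turnMn; congr (_ * turn _).
  rewrite mulNrn exprS invfM -mulr_natr; congr (- _).
  by field; rewrite expf_neq0 // pnatr_eq0.
have kE N x y : k N x = k N y.
  elim: N x y => [x y|N IH x y]; first by rewrite !k0.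
  apply: (@connected_sqrt_constant (k N.+1) (k N x)) => // w.
  by rewrite k_sqr; exact: IH.
have k1 N x : Cnm (k N x) = 1.
  elim: N => [|N IH]; first by rewrite k0 Cnm1.
  have : Cnm (k N.+1 x) ^+ 2 = 1 by rewrite expr2 -CnmM -expr2 k_sqr.
  by move/eqP; rewrite sqrf_eq1 => /orP[/eqP //|/eqP e]; have := Cnm_ge0 (k N.+1 x);
    rewrite e ler0N1.
have cF0 : continuous (fun x => Cmk (F x) 0).
  exact: (continuous_Cmk cF (@cst_continuous X R 0)).
have [M M0 FM] := compact_Cnm_bounded cX cF0.
(* The factor 4 keeps $F/2^N$ below a quarter turn, where the cosine is positive. *)
pose N := Num.bound (M * 4).
have NM : M * 4 < 2 ^+ N.
  apply: lt_le_trans (archi_boundP _) _; first by rewrite mulr_ge0.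
  by rewrite -natrX ler_nat ltnW // ltn_expl.
have [x0 _] := X0.
have [tau tauE] : exists t, turn t = - k N x0 by apply: turn_onto; rewrite CnmN.
have na0R : (n a0)%:~R != 0 :> R by rewrite intr_eq0.
(* With this parameter the factor of [a0] in [v N] is [turn tau] and the other factors are 1, so
   [v N] is opposite to the constant [k N]. *)
pose t := tau * 2 ^+ N / (n a0)%:~R.
have [x [xz xz']] := solenoid_onto sz (idx a0) t.
have vx : v N x = - k N x0.
  rewrite /v (big_rem a0) //= big1_seq => [|a ar]; last first.
    move: ar; rewrite mem_rem_uniq // inE => /and3P[_ aa0 aJ].
    rewrite xz' ?exp1rz //; apply: idxI => //; exact/eqP.
  rewrite mulr1 xz -turnMz -tauE; congr turn.
  rewrite -mulrzr /t; field.
  by rewrite na0R expf_neq0 // pnatr_eq0.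
have : turn (- (F x / 2 ^+ N)) = -1.
  have e : k N x = - k N x0 * turn (- (F x / 2 ^+ N)) by rewrite -vx.
  apply: (mulfI (k_neq0 N x0)).
  by rewrite mulrN1 -[in RHS](kE N x x0) e mulNr opprK.
move=> /(congr1 (@Cre R)) /= c1.
have : 0 < cos (pi *+ 2 * - (F x / 2 ^+ N)).
  apply: cos_gt0_pihalf; rewrite -ltr_norml normrM normrN normrM normfV.
  rewrite (gtr0_norm (pi2_gt0 R)) (ger0_norm (exprn_ge0 N (ler0n R 2))).
  have FxM : `|F x| <= M by apply: le_trans (FM x); exact: (@Cre_le R (Cmk (F x) 0)).
  have Fx4 : `|F x| / 2 ^+ N < 4^-1.
    rewrite ltr_pdivrMr ?exprn_gt0 // mulrC ltr_pdivlMr ?ltr0n //.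
    by apply: le_lt_trans NM; rewrite ler_pM2r ?ltr0n.
  have := ltr_pM2l (pi2_gt0 R) (`|F x| / 2 ^+ N) 4^-1; rewrite Fx4 => /lt_le_trans; apply.
  by have := pi_ge0 R; lra.
by rewrite c1 ltr0N1.
Qed.


Lemma solenoid_cell_open s : open [set x | z s 0%N x <> 1].
Proof.
apply: closed_openC.
apply: closed_eq_Cplx; [exact: solenoid_continuous sz _ _|exact: cst_continuous].
Qed.

Lemma solenoid_cell_nonempty s : [set x | z s 0%N x <> 1] !=set0.
Proof.
(* Half a turn gives the value -1. *)
have [x [xz _]] := solenoid_onto sz s 2^-1; exists x => /=.
rewrite xz expr0 divr1 => /turn_eq1[n n2].
have : (n * 2)%:~R = 1%:~R :> R by rewrite intrM -n2 mulVf // pnatr_eq0.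
move=> /eqP; rewrite eqr_int => /eqP; lia.
Qed.

Lemma solenoid_weight (B : set (set X)) : basis B -> [set: I] #<= B.
Proof.
move=> [oB bB].
have /choice[U UP] : forall s, exists U,
    [/\ B U, U !=set0 & forall x, U x -> z s 0%N x <> 1].
  move=> s; have [x zx] := solenoid_cell_nonempty s.
  have [|U [BU Ux] UV] := bB x [set x | z s 0%N x <> 1].
    by apply: open_nbhs_nbhs; split=> //; exact: solenoid_cell_open.
  by exists U; split=> //; exists x.
apply: (inj_card_le_set (f := U)) => [s _|s s' _ _ UU]; first by have [] := UP s.
apply: contrapT => ss'; have [_ [x Ux] Us] := UP s; have [_ _ Us'] := UP s'.
have [/(Us x)//|/(Us' x)] := solenoid_wedge sz x ss'.
by apply; rewrite -UU.
Qed.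

Lemma Zindependent_extend (A : zmodType) (S0 : set A) : Zindependent S0 ->
  exists2 S, max_Zindependent S & S0 `<=` S.
Proof.
move=> iS0.
(* Adjoining [S0] inside the property encodes the extension and makes the union of the empty chain
   admissible. *)
have [F Find Ftot|S [iS Smax]] := Zorn_bigcup (P := [set S | Zindependent (S `|` S0)]).
  have [F0|F0] := pselect (F !=set0); last first.
    move=> s n us sS; apply: iS0 => // a /sS[[U FU _]|//].
    by exfalso; apply: F0; exists U.
  move=> s n us sS; have [U FU sU] : exists2 U, F U & {in s, forall a, (U `|` S0) a}.
    elim: s {us} sS => [_|a s IH sS]; first by have [U FU] := F0; exists U.
    have [|U FU sU] := IH; first by move=> b bs; apply: sS; rewrite inE bs orbT.
    have [[V FV Va]|S0a] := sS a (mem_head _ _); last first.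
      by exists U => // b; rewrite inE => /orP[/eqP ->|/sU //]; right.
    have [UV|VU] := Ftot _ _ FU FV.
      exists V => // b; rewrite inE => /orP[/eqP ->|/sU[/UV|]]; by [left|right|left].
    exists U => // b; rewrite inE => /orP[/eqP ->|/sU //]; left; exact: VU.
  exact: (Find U FU s n us sU).
exists (S `|` S0); last by move=> a; right.
split=> // S' iS' SS'; apply/seteqP; split=> //.
apply: contrapT => nS'.
apply: (Smax S').
  by split=> [a Sa|S'S]; [apply: SS'; left|apply: nS' => a /S'S; left].
rewrite /=; have -> // : S' `|` S0 = S'.
by apply/seteqP; split=> a; [case=> // S0a; apply: SS'; right|left].
Qed.

Lemma solenoid_rank : rank_ge (cechH1 X) [set: I].
Proof.
have /choice[h hP] : forall s, exists h, represents h (z s 0%N).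
  move=> s; apply: represents_exists; first exact: solenoid_continuous sz _ _.
  exact: solenoid_unit sz _ _.
(* The index type is arbitrary: [bool] gives the injectivity of [h], and the classes themselves give
   the independence of its range. *)
have indep (T : eqType) (J : seq T) (idx : T -> I) (n : T -> int) a0 :
    uniq J -> a0 \in J -> (forall a, a \in J -> a <> a0 -> idx a <> idx a0) ->
    \sum_(a <- J) h (idx a) *~ n a = 0 -> n a0 = 0.
  move=> uJ Ja0 idxI sum0; apply/eqP; apply: contrapT => /negP na0.
  have rep : represents 0 (fun x => \prod_(a <- J) z (idx a) 0%N x ^ n a).
    rewrite -sum0; apply: represents_sum => a; apply: representsMz; exact: hP.
  have [F cF FE] := represents_zero rep.
  exact: (solenoid_no_log uJ Ja0 na0 idxI cF FE).
have hI s s' : h s = h s' -> s = s'.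
  move=> ss'; apply: contrapT => nss'.
  have : (1 : int) = 0; last by [].
  apply: (indep bool [:: true; false] (fun b => if b then s else s')
    (fun b => if b then 1 else -1) true) => //.
    by move=> [] //= _ _ e; apply: nss'.
  by rewrite !big_cons big_nil /= ss' mulr1z mulrN1z addr0 subrr.
have [|S maxS hS] := @Zindependent_extend (cechH1 X) (range h).
  move=> s n us sS sum0 a0 sa0.
  have /choice[idx idxE] : forall a, exists i, range h a -> h i = a.
    move=> a; have [[i _ <-]|na] := pselect (range h a); first by exists i.
    by have [i _ _] := sS a0 sa0; exists i.
  apply: (indep _ s idx n a0) => //.
    move=> a sa aa0 e; apply: aa0.
    by rewrite -(idxE a (sS a sa)) e idxE //; exact: sS.
  rewrite -[RHS]sum0; apply: eq_big_seq => a sa.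
  by rewrite idxE //; exact: sS.
exists S => //; apply: (inj_card_le_set (f := h)) => [s _|s s' _ _]; last exact: hI.
by apply: hS; exists s.
Qed.

End Rank.

(** * Counting the tasks *)

Section PowerCube.
Variables (R : realType) (K : Type) (infK : infinite_set [set: K]).
Local Notation L := (set K).

Lemma embeds_code : embeds (code L) L.
Proof.
apply: pow_prod => //; last exact: pow_count.
by apply: pow_seq => //; apply: pow_prod => //; [exact: embeds_refl|exact: pow_count].
Qed.

(** Boxes being countable, their sets number only $2^{\aleph_0}$; the sequences of functions are
    covered by the closure of $2^\kappa$ under countable powers. *)
Lemma embeds_task : embeds (task R L) L.
Proof.
apply: pow_prod => //; last exact: pow_count_set.
apply: pow_nat_fun => //.
apply: embeds_trans (embeds_continuous (@compact_cube R L) (@continuous_crd R L)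
  (@crd_inj R L)) _.
apply: pow_nat_fun => //; apply: pow_seq => //; apply: pow_prod => //.
  exact: embeds_code.
exact: pow_complex.
Qed.

Lemma embeds_coordinates :
  embeds (task R L * (nat * bool) + L * nat * bool) L.
Proof.
apply: pow_sum => //.
  by apply: pow_prod => //; [exact: embeds_task|exact: pow_count].
apply: pow_prod => //; last exact: pow_count.
by apply: pow_prod => //; [exact: embeds_refl|exact: pow_count].
Qed.

End PowerCube.

Theorem theorem4p17 (R : realType) (K : Type)
    (infK : infinite_set [set: K]) :
  exists X : topologicalType,
    [/\ co_existentially_closed R X,
        has_weight X [set: set K]
      & rank_ge (cechH1 X) [set: set K]].
Proof.
(* A single injection of the disjoint sum keeps the coordinates of the wedge apart from those
   reserved for tasks. *)
have [f fI] := embeds_coordinates R infK.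
pose enc t := f (inl t); pose base c := f (inr c).
have encI : injective enc by move=> t t' /fI[].
have baseI : injective base by move=> c c' /fI[].
pose S0 := wedge_support base; pose P0 := @wedge_cylinder R _ _ base.
have S0_enc t : ~ S0 (enc t) by move=> [c _ /fI].
have clP0 : closed P0 by exact: closed_wedge_cylinder.
have cP0 : connected P0 by exact: (@connected_wedge_cylinder R _ (set K) set0 base baseI).
have P00 : P0 !=set0 by exists (@wedge_line R _ _ base set0 0); exact: wedge_line_cylinder.
have satP0 x y : agree S0 x y -> P0 x -> P0 y by exact: wedge_cylinder_agree.
have [S [P [stSP maxSP]]] := maximal_stage S0_enc clP0 cP0 satP0.
pose X := stage_space S P; exists X.
have contX : continuum X := continuum_stage_space P00 stSP.
have [_ cX _ _] := contX.
have sz : solenoid_map (fun s n (x : X) => wedge_coord base s n (set_val x)).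
  have [_ _ _ _ [S0S PP0 P0P]] := stSP.
  apply: solenoid_map_wedge => //.
  - exact: set_val_continuous.
  - by move=> x; apply: PP0; have [] : stage_set S P (set_val x) by exact: set_valP.
  - move=> y /P0P[x Px yx]; have [w xw] := stage_space_points stSP Px.
    by exists w; exact: agree_trans yx (agree_sub S0S xw).
split.
- by split=> //; exact: (stage_space_existentially_closed encI P00 stSP maxSP).
- have weight := solenoid_weight sz.
  split; last exact: weight.
  pose c l (x : X) := crd l (set_val x).
  have cc l : continuous (c l).
    by move=> x; apply: continuous_comp; [exact: set_val_continuous|exact: continuous_crd].
  have csep (x y : X) : (forall l, c l x = c l y) -> x = y.
    by move=> xy; apply: val_inj; exact: crd_inj.
  have bX := basis_code_set cX cc csep.
  exists (range (code_set c)) => //; rewrite card_eq_le weight // andbT.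
  apply: card_le_trans (card_image_le _ _) _.
  by have [g gI] := embeds_code infK; apply: (inj_card_le_set (f := g)) => // x y _ _ /gI.
- exact: (solenoid_rank contX sz).
Qed.
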